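(* In the setting below, assume $\tau$ and $w$ are smooth along $\gamma$. Then there is a function $B(s)$ such that $$l(s)\sin\delta\,\big(k(s)l(s)-\sin\delta\big)\,\dot\tau(s)+B(s)\tau(s)=0 .$$ Moreover, if $\tau(s_0)=0$ for some $s_0$ (i.e. $\dot n(s_0)+k(s_0)v(s_0)=0$), then $\tau\equiv 0$ along $\gamma$.
   Context: Let $S\subset\mathbf{R}^d$ be a Gutkin billiard table for the angle $\delta\in(0,\pi/2)$: a smooth closed hypersurface bounding a compact convex domain, with all principal curvatures strictly positive, such that for all distinct $p,q\in S$, if the angle between $\overrightarrow{pq}$ and $T_pS$ equals $\delta$ then the angle between $\overrightarrow{pq}$ and $T_qS$ equals $\delta$. Let $\gamma(s)$ be an arc-length parametrized geodesic of $S$, $v=\dot\gamma$, $n(s)$ the unit inner normal of $S$ at $\gamma(s)$. Since $\gamma$ is a geodesic, $\dot v=k(s)n(s)$ with curvature $k(s)>0$. Write $\frac{d}{ds}n(s)=-k(s)v(s)+\tau(s)w(s)$ where $w(s)$ is a unit vector orthogonal to $v(s)$ and $n(s)$. Let $z(s)=\cos\delta\,v(s)+\sin\delta\,n(s)$ and let $l(s)>0$ be the length of the chord of $S$ from $\gamma(s)$ in direction $z(s)$. *)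

(* Defs.v *)
From Stdlib Require Import Reals Lra List.
Open Scope R_scope.

(** Points/vectors of R^d are represented by [nat -> R]; a genuine point of
    R^d is one whose coordinates of index >= d vanish ([inRd d]). *)
Definition vec := nat -> R.

Fixpoint sumd (d : nat) (f : nat -> R) : R :=
  match d with O => 0 | S d' => sumd d' f + f d' end.

Definition dot (d : nat) (u v : vec) : R := sumd d (fun i => u i * v i).
Definition vnorm (d : nat) (u : vec) : R := sqrt (dot d u u).
Definition vadd (u v : vec) : vec := fun i => u i + v i.
Definition vsub (u v : vec) : vec := fun i => u i - v i.
Definition vscal (a : R) (u : vec) : vec := fun i => a * u i.
Definition basis (i : nat) : vec := fun j => if Nat.eqb i j then 1 else 0.
Definition inRd (d : nat) (x : vec) : Prop := forall i, (d <= i)%nat -> x i = 0.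

Definition cont_Rd (d : nat) (G : vec -> R) : Prop :=
  forall x, inRd d x -> forall eps, 0 < eps ->
    exists del, 0 < del /\ forall y, inRd d y -> vnorm d (vsub y x) < del ->
      Rabs (G y - G x) < eps.

Definition smooth_Rd (d : nat) (F : vec -> R) : Prop :=
  exists D : list nat -> vec -> R,
    (forall x, inRd d x -> D nil x = F x) /\
    (forall l, cont_Rd d (D l)) /\
    (forall l i x, (i < d)%nat -> inRd d x ->
       derivable_pt_lim (fun t => D l (vadd x (vscal t (basis i)))) 0 (D (i :: l) x)).

Definition partial_at (F : vec -> R) (x : vec) (i : nat) (g : R) : Prop :=
  derivable_pt_lim (fun t => F (vadd x (vscal t (basis i)))) 0 g.

Definition smooth1 (f : R -> R) : Prop :=
  exists fs : nat -> R -> R, (forall x, fs O x = f x) /\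
    (forall n x, derivable_pt_lim (fs n) x (fs (S n) x)).

(** Unit inner normal of the level set {F = 0} (interior = {F <= 0}),
    computed from the gradient [gradF x]. *)
Definition inner_normal (d : nat) (gradF : vec -> vec) (x : vec) : vec :=
  vscal (- / vnorm d (gradF x)) (gradF x).

(** Angle between a nonzero vector [u] and the hyperplane with unit normal [N]. *)
Definition angle_hyp (d : nat) (u N : vec) : R :=
  asin (Rabs (dot d u N) / vnorm d u).

(** Data of a smooth closed hypersurface S = {F = 0} bounding the compact
    convex domain {F <= 0}, with all principal curvatures strictly positive.
    [gradF], [hessF] are the gradient and Hessian of [F]. *)
Definition strictly_convex_hypersurface (d : nat) (F : vec -> R)
    (gradF : vec -> vec) (hessF : vec -> nat -> nat -> R) : Prop :=
  smooth_Rd d F /\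
  (forall x, inRd d x -> inRd d (gradF x)) /\
  (forall x i, inRd d x -> (i < d)%nat -> partial_at F x i (gradF x i)) /\
  (forall x i j, inRd d x -> (i < d)%nat -> (j < d)%nat ->
      partial_at (fun y => gradF y j) x i (hessF x i j)) /\
  (forall x, inRd d x -> F x = 0 -> 0 < vnorm d (gradF x)) /\
  (exists M, forall x, inRd d x -> F x <= 0 -> vnorm d x <= M) /\
  (forall x y t, inRd d x -> inRd d y -> F x <= 0 -> F y <= 0 -> 0 <= t <= 1 ->
      F (vadd (vscal (1 - t) x) (vscal t y)) <= 0) /\
  (* all principal curvatures > 0: the second fundamental form w.r.t. the
     inner normal, II(u,u) = Hess F(u,u) / |grad F|, is positive definite on T_xS *)
  (forall x u, inRd d x -> F x = 0 -> inRd d u -> 0 < vnorm d u ->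
      dot d u (gradF x) = 0 ->
      0 < sumd d (fun i => sumd d (fun j => hessF x i j * u i * u j))
            / vnorm d (gradF x)).

Definition onS (d : nat) (F : vec -> R) (x : vec) : Prop := inRd d x /\ F x = 0.

Definition gutkin (d : nat) (F : vec -> R) (gradF : vec -> vec) (delta : R) : Prop :=
  forall p q, onS d F p -> onS d F q -> 0 < vnorm d (vsub q p) ->
    angle_hyp d (vsub q p) (inner_normal d gradF p) = delta ->
    angle_hyp d (vsub q p) (inner_normal d gradF q) = delta.

(* Main.v *)
(** Let [Gamma = gamma + l z] be the far end of the chord, [n] and [N] the inner normals at
    [gamma] and [Gamma], [e = - sin delta v + cos delta n], [a = k l - sin delta] and
    [b = l tau sin delta], so that [Gamma' = (cos delta + l') z + a e + b w].
    Differentiating the Gutkin property along chords whose end is held fixed shows that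
    [a e + b w] is a nonzero multiple of [N + sin delta z]. Hence [Q = - b e + a w] is
    tangent to the hypersurface at [Gamma]. Moving the foot along [w] and the end along
    [Q], and using the symmetry of the shape operators, gives [<N', Q> = tau sin delta]
    (the curve [Gamma] is again a geodesic). Differentiating [<N, Q> = 0] is then the
    equation for [tau], with
    [B = sin delta ((a + sin delta (cos delta + l') / cos delta) l' - l a')].
    Finally [cos delta ^ 2 (a ^ 2 + b ^ 2) = sin delta ^ 2 (cos delta + l') ^ 2 <> 0],
    so [a <> 0] wherever [tau = 0] and uniqueness for linear equations applies there. *)
From Stdlib Require Import Reals Lra Lia List FunctionalExtensionality ClassicalEpsilon.
From Coquelicot Require Import Coquelicot.
Require Import Defs.
Open Scope R_scope.

(** * Vector algebra *)

(** The Gutkin property is a pointwise condition on chords and no regularity of [l] is given, so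
    differentiability has to be produced first. Chords are followed along curves by an implicit
    function argument that uses derivatives of the curves at one parameter only; convexity and the
    Gutkin angle make the far end of a chord unique, which identifies the branch so found with [l].
    The direction of the motion of the end comes from linear duality. With the end fixed, keeping
    the angle at the foot stationary is one linear condition on the tangent motion of the foot,
    orthogonality to a vector [Y]; the Gutkin property then forces orthogonality to
    [N + sin delta z]. Hence the part of [N + sin delta z] tangent at the foot is a multiple of [Y],
    and orthogonality to [z] fixes its remaining normal component. The relation between [a], [b] and
    [l'] holds because [N + sin delta z] has length [cos delta]. Continuity of [B] is part of the
    conclusion because the local uniqueness argument for the linear equation rests on it. *)

Lemma sumd_ext (d : nat) (f g : nat -> R) :
  (forall i, (i < d)%nat -> f i = g i) -> sumd d f = sumd d g.
Proof.
  induction d as [|d IH]; intros H; simpl; [reflexivity|].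
  rewrite IH by (intros; apply H; lia). rewrite (H d) by lia. reflexivity.
Qed.

Lemma sumd_plus (d : nat) (f g : nat -> R) :
  sumd d (fun i => f i + g i) = sumd d f + sumd d g.
Proof. induction d as [|d IH]; simpl; [ring|]. rewrite IH. ring. Qed.

Lemma sumd_scal (d : nat) (a : R) (f : nat -> R) :
  sumd d (fun i => a * f i) = a * sumd d f.
Proof. induction d as [|d IH]; simpl; [ring|]. rewrite IH. ring. Qed.

Lemma sumd_zero (d : nat) : sumd d (fun _ => 0) = 0.
Proof. induction d as [|d IH]; simpl; [|rewrite IH]; ring. Qed.

Lemma sumd_eq0 (d : nat) (f : nat -> R) :
  (forall i, (i < d)%nat -> f i = 0) -> sumd d f = 0.
Proof. intros H. rewrite (sumd_ext d f (fun _ => 0) H). apply sumd_zero. Qed.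

Lemma sumd_le (d : nat) (f g : nat -> R) :
  (forall i, (i < d)%nat -> f i <= g i) -> sumd d f <= sumd d g.
Proof.
  induction d as [|d IH]; intros H; simpl; [lra|].
  apply Rplus_le_compat; [apply IH; intros; apply H|apply H]; lia.
Qed.

Lemma sumd_nonneg (d : nat) (f : nat -> R) :
  (forall i, (i < d)%nat -> 0 <= f i) -> 0 <= sumd d f.
Proof. intros H. rewrite <- (sumd_zero d). apply sumd_le, H. Qed.

Lemma sumd_exchange (d d' : nat) (f : nat -> nat -> R) :
  sumd d (fun i => sumd d' (fun j => f i j)) = sumd d' (fun j => sumd d (fun i => f i j)).
Proof.
  induction d as [|d IH]; simpl.
  - symmetry. apply sumd_zero.
  - rewrite IH, <- sumd_plus. reflexivity.
Qed.

Lemma sumd_ge_term (d : nat) (f : nat -> R) (i : nat) :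
  (forall j, (j < d)%nat -> 0 <= f j) -> (i < d)%nat -> f i <= sumd d f.
Proof.
  induction d as [|d IH]; intros H Hi; [lia|]. simpl.
  destruct (Nat.eq_dec i d) as [->|Hne].
  - assert (0 <= sumd d f) by (apply sumd_nonneg; intros; apply H; lia). lra.
  - assert (f i <= sumd d f) by (apply IH; [intros; apply H; lia|lia]).
    assert (0 <= f d) by (apply H; lia). lra.
Qed.

Lemma dot_comm (d : nat) (u v : vec) : dot d u v = dot d v u.
Proof. apply sumd_ext. intros. ring. Qed.

Lemma dot_add_l (d : nat) (u v x : vec) : dot d (vadd u v) x = dot d u x + dot d v x.
Proof. unfold dot, vadd. rewrite <- sumd_plus. apply sumd_ext. intros. ring. Qed.

Lemma dot_scal_l (d : nat) (a : R) (u x : vec) : dot d (vscal a u) x = a * dot d u x.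
Proof. unfold dot, vscal. rewrite <- sumd_scal. apply sumd_ext. intros. ring. Qed.

Lemma dot_add_r (d : nat) (u v x : vec) : dot d x (vadd u v) = dot d x u + dot d x v.
Proof. rewrite !(dot_comm d x). apply dot_add_l. Qed.

Lemma dot_scal_r (d : nat) (a : R) (u x : vec) : dot d x (vscal a u) = a * dot d x u.
Proof. rewrite !(dot_comm d x). apply dot_scal_l. Qed.

Lemma dot_zero_r (d : nat) (u : vec) : dot d u (fun _ => 0) = 0.
Proof. apply sumd_eq0. intros. ring. Qed.

Lemma dot_self_nonneg (d : nat) (u : vec) : 0 <= dot d u u.
Proof. apply sumd_nonneg. intros. nra. Qed.

Lemma dot_self_zero (d : nat) (u : vec) :
  dot d u u = 0 -> forall x, dot d u x = 0.
Proof.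
  intros H x. apply sumd_eq0. intros i Hi.
  assert (u i * u i <= 0).
  { rewrite <- H. apply (sumd_ge_term d (fun i => u i * u i)); [intros; nra|exact Hi]. }
  replace (u i) with 0 by nra. ring.
Qed.

Lemma vnorm_sq (d : nat) (u : vec) : vnorm d u * vnorm d u = dot d u u.
Proof. apply sqrt_sqrt, dot_self_nonneg. Qed.

Lemma vnorm_nonneg (d : nat) (u : vec) : 0 <= vnorm d u.
Proof. apply sqrt_pos. Qed.

Lemma vnorm_scal (d : nat) (a : R) (u : vec) :
  0 <= a -> vnorm d (vscal a u) = a * vnorm d u.
Proof.
  intros Ha. unfold vnorm. rewrite dot_scal_l, dot_scal_r.
  replace (a * (a * dot d u u)) with ((a * a) * dot d u u) by ring.
  rewrite sqrt_mult by (try apply dot_self_nonneg; nra).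
  rewrite sqrt_square by exact Ha. reflexivity.
Qed.

Lemma vnorm_le (d : nat) (u v : vec) :
  (forall i, (i < d)%nat -> Rabs (u i) <= Rabs (v i)) -> vnorm d u <= vnorm d v.
Proof.
  intros H. apply sqrt_le_1; try apply dot_self_nonneg.
  apply sumd_le. intros i Hi. apply Rsqr_le_abs_1, H, Hi.
Qed.

Lemma vnorm_le_sum (d : nat) (u : vec) : vnorm d u <= sumd d (fun i => Rabs (u i)).
Proof.
  assert (H0 : 0 <= sumd d (fun i => Rabs (u i)))
    by (apply sumd_nonneg; intros; apply Rabs_pos).
  rewrite <- (sqrt_square _ H0). apply sqrt_le_1; [apply dot_self_nonneg|nra|].
  clear H0. unfold dot. induction d as [|d IH]; simpl; [lra|].
  assert (0 <= sumd d (fun i => Rabs (u i)))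
    by (apply sumd_nonneg; intros; apply Rabs_pos).
  assert (Rabs (u d) * Rabs (u d) = u d * u d) by apply (eq_sym (Rsqr_abs (u d))).
  pose proof (Rabs_pos (u d)). nra.
Qed.

Lemma inRd_add (d : nat) (u v : vec) : inRd d u -> inRd d v -> inRd d (vadd u v).
Proof. intros Hu Hv i Hi. unfold vadd. rewrite Hu, Hv by exact Hi. ring. Qed.

Lemma inRd_scal (d : nat) (a : R) (u : vec) : inRd d u -> inRd d (vscal a u).
Proof. intros Hu i Hi. unfold vscal. rewrite Hu by exact Hi. ring. Qed.

Lemma inRd_basis (d i : nat) : (i < d)%nat -> inRd d (basis i).
Proof. intros Hi j Hj. unfold basis. destruct (Nat.eqb_spec i j); [lia|reflexivity]. Qed.

#[local] Hint Resolve inRd_add inRd_scal inRd_basis : inRd.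

(** * Derivatives along curves *)

Lemma derivable_pt_lim_value (f : R -> R) (x l l' : R) :
  derivable_pt_lim f x l' -> l' = l -> derivable_pt_lim f x l.
Proof. intros H <-. exact H. Qed.

Lemma derivable_pt_lim_local (f g : R -> R) (x l eta : R) :
  0 < eta -> (forall t, Rabs (t - x) < eta -> f t = g t) ->
  derivable_pt_lim f x l -> derivable_pt_lim g x l.
Proof.
  intros He Hfg H eps Heps. destruct (H eps Heps) as [del Hd].
  assert (Hm : 0 < Rmin del eta) by (apply Rmin_pos; [apply cond_pos|exact He]).
  exists (mkposreal _ Hm). simpl. intros h Hh Hlt.
  rewrite <- !Hfg.
  - apply Hd; [exact Hh|]. eapply Rlt_le_trans; [exact Hlt|apply Rmin_l].
  - rewrite Rminus_diag, Rabs_R0. exact He.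
  - replace (x + h - x) with h by ring.
    eapply Rlt_le_trans; [exact Hlt|apply Rmin_r].
Qed.

Lemma derivable_pt_lim_eqf (f g : R -> R) (x l : R) :
  (forall t, f t = g t) -> derivable_pt_lim f x l -> derivable_pt_lim g x l.
Proof. intros H. apply (derivable_pt_lim_local f g x l 1); [lra|auto]. Qed.

Lemma derivable_pt_lim_cont (f : R -> R) (x l : R) :
  derivable_pt_lim f x l -> continuity_pt f x.
Proof. intros H. apply derivable_continuous_pt. exists l. exact H. Qed.

Lemma continuity_pt_near (f : R -> R) (x eps : R) :
  continuity_pt f x -> 0 < eps ->
  exists eta, 0 < eta /\ forall t, Rabs (t - x) < eta -> Rabs (f t - f x) < eps.
Proof.
  intros H He. destruct (H eps He) as [eta [H0 H1]]. exists eta. split; [exact H0|].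
  intros t Ht. destruct (Req_dec t x) as [->|Hne].
  - rewrite Rminus_diag, Rabs_R0. exact He.
  - apply H1. repeat split; [congruence|exact Ht].
Qed.

(** All coordinates are differentiated, also those of index at least [d], so that the derivative of
    a curve in R^d is again in R^d. *)
Definition vderiv (c : R -> vec) (t : R) (u : vec) : Prop :=
  forall i, derivable_pt_lim (fun s => c s i) t (u i).

Lemma vderiv_const (x : vec) (t : R) : vderiv (fun _ => x) t (fun _ => 0).
Proof. intros i. apply derivable_pt_lim_const. Qed.

Lemma vderiv_add (c e : R -> vec) (t : R) (u x : vec) :
  vderiv c t u -> vderiv e t x -> vderiv (fun s => vadd (c s) (e s)) t (vadd u x).
Proof. intros Hc He i. apply (derivable_pt_lim_plus _ _ _ _ _ (Hc i) (He i)). Qed.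

Lemma vderiv_scal (f : R -> R) (c : R -> vec) (t f' : R) (u : vec) :
  derivable_pt_lim f t f' -> vderiv c t u ->
  vderiv (fun s => vscal (f s) (c s)) t (vadd (vscal f' (c t)) (vscal (f t) u)).
Proof. intros Hf Hc i. apply (derivable_pt_lim_mult _ _ _ _ _ Hf (Hc i)). Qed.

Lemma vderiv_value (c : R -> vec) (t : R) (u x : vec) :
  vderiv c t u -> (forall i, u i = x i) -> vderiv c t x.
Proof. intros H E i. rewrite <- E. apply H. Qed.

Lemma vderiv_inRd (d : nat) (c : R -> vec) (t : R) (u : vec) :
  (forall s, inRd d (c s)) -> vderiv c t u -> inRd d u.
Proof.
  intros Hc Hu i Hi. apply (uniqueness_limite (fun s => c s i) t); [apply Hu|].
  apply (derivable_pt_lim_eqf (fun _ => 0)); [|apply derivable_pt_lim_const].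
  intros s. symmetry. apply Hc, Hi.
Qed.

Lemma derivable_pt_lim_sumd (d : nat) (f : R -> nat -> R) (f' : nat -> R) (t : R) :
  (forall i, (i < d)%nat -> derivable_pt_lim (fun s => f s i) t (f' i)) ->
  derivable_pt_lim (fun s => sumd d (f s)) t (sumd d f').
Proof.
  induction d as [|d IH]; intros H; simpl; [apply derivable_pt_lim_const|].
  apply (derivable_pt_lim_plus (fun s => sumd d (f s)) (fun s => f s d)).
  - apply IH. intros. apply H. lia.
  - apply H. lia.
Qed.

Lemma derivable_pt_lim_dot (d : nat) (c e : R -> vec) (t : R) (u x : vec) :
  vderiv c t u -> vderiv e t x ->
  derivable_pt_lim (fun s => dot d (c s) (e s)) t (dot d u (e t) + dot d (c t) x).
Proof.
  intros Hc He. unfold dot. rewrite <- sumd_plus.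
  apply (derivable_pt_lim_sumd d (fun s i => c s i * e s i)). intros i _.
  apply (derivable_pt_lim_mult _ _ _ _ _ (Hc i) (He i)).
Qed.

Lemma continuity_pt_dot (d : nat) (c e : R -> vec) (t : R) :
  (forall i, (i < d)%nat -> continuity_pt (fun s => c s i) t) ->
  (forall i, (i < d)%nat -> continuity_pt (fun s => e s i) t) ->
  continuity_pt (fun s => dot d (c s) (e s)) t.
Proof.
  unfold dot. induction d as [|d IH]; intros Hc He; simpl.
  - apply continuity_pt_const. intros ? ?. reflexivity.
  - apply (continuity_pt_plus (fun s => sumd d (fun i => c s i * e s i))
             (fun s => c s d * e s d)).
    + apply IH; intros; [apply Hc|apply He]; lia.
    + apply (continuity_pt_mult (fun s => c s d) (fun s => e s d)); [apply Hc|apply He]; lia.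
Qed.

(** * Implicit selections and linear equations on the line *)

(** The product form says that [f (x + h)] has the sign of [D * h], on both sides of [x] at once. *)
Lemma derivable_pt_lim_sign (f : R -> R) (x D : R) :
  f x = 0 -> derivable_pt_lim f x D -> D <> 0 ->
  exists eta, 0 < eta /\ forall h, h <> 0 -> Rabs h < eta -> 0 < f (x + h) * D * h.
Proof.
  intros H0 H HD. destruct (H (Rabs D) (Rabs_pos_lt _ HD)) as [eta He].
  exists eta. split; [apply cond_pos|]. intros h Hh Hlt. specialize (He h Hh Hlt).
  rewrite H0, Rminus_0_r in He.
  replace (f (x + h) * D * h) with (f (x + h) / h * D * (h * h)) by (field; exact Hh).
  apply Rmult_lt_0_compat; [|nra]. revert He. unfold Rabs.
  destruct (Rcase_abs (f (x + h) / h - D)), (Rcase_abs D); intros; nra.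
Qed.

(** An arbitrary [P] need not contain a minimizer of [f]; the slack [e] lets the infimum be
    approached instead. *)
Lemma near_minimizer (P : R -> Prop) (f : R -> R) (e : R) :
  (exists r, P r) -> (forall r, 0 <= f r) -> 0 < e ->
  exists r, P r /\ forall r', P r' -> f r <= f r' + e.
Proof.
  intros [r0 Hr0] Hf He.
  destruct (completeness (fun y => exists r, P r /\ y = - f r)) as [M [Hub Hlub]].
  - exists 0. intros y [r [_ ->]]. pose proof (Hf r). lra.
  - exists (- f r0), r0. auto.
  - destruct (classic (exists r, P r /\ M - e < - f r)) as [[r [Hr HM]]|Hno].
    + exists r. split; [exact Hr|]. intros r' Hr'.
      assert (- f r' <= M) by (apply Hub; exists r'; auto). lra.
    + assert (M <= M - e); [|lra]. apply Hlub. intros y [r [Hr ->]].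
      apply Rnot_lt_le. intros Hlt. apply Hno. exists r. auto.
Qed.

(* Choosing almost the closest solution to the tangent line makes the selected
   branch differentiable without any local uniqueness of solutions. *)
Lemma derivable_selection (P : R -> R -> Prop) (t0 r0 m : R) :
  P t0 r0 ->
  (forall eps, 0 < eps -> exists eta, 0 < eta /\ forall h, h <> 0 -> Rabs h < eta ->
     exists r, P (t0 + h) r /\ Rabs (r - (r0 + m * h)) <= eps * Rabs h) ->
  exists rho eta, 0 < eta /\ rho t0 = r0 /\ derivable_pt_lim rho t0 m /\
    forall t, Rabs (t - t0) < eta -> P t (rho t).
Proof.
  intros HP H.
  (* The slack [(t - t0) * (t - t0)] is negligible against [t - t0], so it does not disturb the
     derivative; it vanishes at [t0], which forces the selected value there to be [r0]. *)
  set (good := fun t r => P t r /\ forall r', P t r' ->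
    Rabs (r - (r0 + m * (t - t0))) <= Rabs (r' - (r0 + m * (t - t0))) + (t - t0) * (t - t0)).
  set (rho := fun t => epsilon (inhabits r0) (good t)).
  assert (Hgood : forall t, (exists r, P t r) -> good t (rho t)).
  { intros t Ht. unfold rho. apply epsilon_spec. destruct (Req_dec t t0) as [->|Hne].
    - exists r0. split; [exact HP|]. intros r' _. rewrite Rminus_diag.
      replace (r0 - (r0 + m * 0)) with 0 by ring. rewrite Rabs_R0.
      pose proof (Rabs_pos (r' - (r0 + m * 0))). lra.
    - apply near_minimizer; [exact Ht|intros; apply Rabs_pos|].
      destruct (Rtotal_order t t0) as [?|[?|?]]; nra. }
  assert (E0 : rho t0 = r0).
  { destruct (Hgood t0 (ex_intro _ r0 HP)) as [_ Hr]. specialize (Hr r0 HP).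
    rewrite Rminus_diag in Hr.
    replace (r0 - (r0 + m * 0)) with 0 in Hr by ring. rewrite Rabs_R0 in Hr.
    apply Rminus_diag_uniq. revert Hr. unfold Rabs.
    destruct (Rcase_abs (rho t0 - (r0 + m * 0))); lra. }
  destruct (H 1 Rlt_0_1) as [eta1 [Heta1 H1]].
  exists rho, eta1. split; [exact Heta1|]. split; [exact E0|]. split.
  - intros eps Heps. destruct (H (eps / 2) ltac:(lra)) as [eta [Heta H2]].
    (* Half of [eps] bounds the distance of the solution [r] to the tangent line, the other half
       absorbs the slack [h * h]. *)
    assert (Hm : 0 < Rmin eta (eps / 2)) by (apply Rmin_pos; lra).
    exists (mkposreal _ Hm). simpl. intros h Hne Hh.
    destruct (H2 h Hne (Rlt_le_trans _ _ _ Hh (Rmin_l _ _))) as [r [Hr Hrh]].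
    destruct (Hgood (t0 + h) (ex_intro _ r Hr)) as [_ Hg]. specialize (Hg r Hr).
    replace (t0 + h - t0) with h in Hg by ring. rewrite E0.
    assert (Hh2 : Rabs h < eps / 2) by (eapply Rlt_le_trans; [exact Hh|apply Rmin_r]).
    assert (Hpos : 0 < Rabs h) by (apply Rabs_pos_lt; exact Hne).
    replace ((rho (t0 + h) - r0) / h - m) with ((rho (t0 + h) - (r0 + m * h)) * / h)
      by (field; exact Hne).
    rewrite Rabs_mult, Rabs_inv. apply (Rmult_lt_reg_r (Rabs h)); [exact Hpos|].
    rewrite Rmult_assoc, Rinv_l, Rmult_1_r by lra.
    assert (h * h = Rabs h * Rabs h) by apply (Rsqr_abs h). nra.
  - intros t Ht. destruct (Req_dec t t0) as [->|Hne]; [rewrite E0; exact HP|].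
    apply Hgood. destruct (H1 (t - t0) ltac:(lra) Ht) as [r [Hr _]].
    exists r. replace (t0 + (t - t0)) with t in Hr by ring. exact Hr.
Qed.

Lemma continuity_add (f g : R -> R) :
  continuity f -> continuity g -> continuity (fun x => f x + g x).
Proof. apply continuity_plus. Qed.

Lemma continuity_mul (f g : R -> R) :
  continuity f -> continuity g -> continuity (fun x => f x * g x).
Proof. apply continuity_mult. Qed.

Lemma continuity_cst (a : R) : continuity (fun _ => a).
Proof. apply continuity_const. intros x y. reflexivity. Qed.

Lemma derivable_continuity (f f' : R -> R) :
  (forall x, derivable_pt_lim f x (f' x)) -> continuity f.
Proof. intros H x. exact (derivable_pt_lim_cont f x (f' x) (H x)). Qed.

(** Connectedness: the supremum of the zeros up to [x] is a zero by continuity, and openness of the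
    zero set would push it further unless it equals [x]. *)
Lemma zero_open_right (f : R -> R) (x0 : R) :
  continuity f ->
  (forall x, f x = 0 -> exists eta, 0 < eta /\ forall y, Rabs (y - x) < eta -> f y = 0) ->
  f x0 = 0 -> forall x, x0 <= x -> f x = 0.
Proof.
  intros Hc Ho H0 x Hx.
  destruct (completeness (fun y => y <= x /\ f y = 0)) as [m [Hub Hlub]].
  { exists x. intros y [Hy _]. exact Hy. }
  { exists x0. auto. }
  assert (Hmx : m <= x) by (apply Hlub; intros y [Hy _]; exact Hy).
  assert (Hm : f m = 0).
  { destruct (Req_dec (f m) 0) as [E|Hne]; [exact E|exfalso].
    destruct (continuity_pt_near f m (Rabs (f m)) (Hc m) (Rabs_pos_lt _ Hne)) as [eta [He H]].
    assert (m <= m - eta / 2); [|lra]. apply Hlub. intros y [Hy Hfy].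
    apply Rnot_lt_le. intros Hlt. assert (y <= m) by (apply Hub; auto).
    specialize (H y). rewrite Hfy in H.
    assert (Hy2 : Rabs (y - m) < eta) by (apply Rabs_def1; lra).
    specialize (H Hy2). rewrite Rminus_0_l, Rabs_Ropp in H. lra. }
  destruct (Req_dec m x) as [->|Hne]; [exact Hm|exfalso].
  destruct (Ho m Hm) as [eta [He H]]. set (h := Rmin (eta / 2) (x - m)).
  assert (Hh : 0 < h) by (apply Rmin_pos; lra).
  assert (h <= eta / 2) by apply Rmin_l. assert (h <= x - m) by apply Rmin_r.
  assert (m + h <= m); [|lra]. apply Hub. split; [lra|]. apply H.
  apply Rabs_def1; lra.
Qed.

Lemma zero_open_everywhere (f : R -> R) (x0 : R) :
  continuity f ->
  (forall x, f x = 0 -> exists eta, 0 < eta /\ forall y, Rabs (y - x) < eta -> f y = 0) ->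
  f x0 = 0 -> forall x, f x = 0.
Proof.
  intros Hc Ho H0 x. destruct (Rle_dec x0 x) as [Hx|Hx].
  - exact (zero_open_right f x0 Hc Ho H0 x Hx).
  - rewrite <- (Ropp_involutive x).
    apply (zero_open_right (fun y => f (- y)) (- x0)); [| |rewrite Ropp_involutive; exact H0|lra].
    + intros y. apply (continuity_pt_comp Ropp f); [|apply Hc].
      apply (derivable_pt_lim_cont Ropp y (-1)). apply is_derive_Reals.
      auto_derive; [exact I|ring].
    + intros y Hy. destruct (Ho _ Hy) as [eta [He H]]. exists eta. split; [exact He|].
      intros y' Hy'. apply H. replace (- y' - - y) with (- (y' - y)) by ring.
      rewrite Rabs_Ropp. exact Hy'.
Qed.

(** Close to [x0] the bounds [|A| >= |A x0| / 2] and [|B| <= |B x0| + 1] turn the equation into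
    [|f'| <= M |f|]. On an interval of radius [eta] with [eta * M <= 1/2], the mean value theorem
    from [x0] to a maximum point [m] of [|f|] gives [|f m| <= |f m| / 2], so the maximum is zero. *)
Lemma linear_ode_zero (f f' A B : R -> R) (x0 : R) :
  (forall x, derivable_pt_lim f x (f' x)) -> continuity A -> continuity B ->
  (forall x, A x * f' x + B x * f x = 0) -> A x0 <> 0 -> f x0 = 0 ->
  exists eta, 0 < eta /\ forall x, Rabs (x - x0) < eta -> f x = 0.
Proof.
  intros Hf HA HB Hode HA0 H0.
  pose proof (Rabs_pos_lt _ HA0) as HA0'.
  destruct (continuity_pt_near A x0 (Rabs (A x0) / 2) (HA x0) ltac:(lra)) as [e1 [He1 H1]].
  destruct (continuity_pt_near B x0 1 (HB x0) Rlt_0_1) as [e2 [He2 H2]].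
  set (M := 2 * (Rabs (B x0) + 1) / Rabs (A x0)).
  assert (HM : 0 < M).
  { unfold M. pose proof (Rabs_pos (B x0)). apply Rdiv_lt_0_compat; lra. }
  set (eta := Rmin (Rmin e1 e2) (/ M) / 2).
  assert (HiM : 0 < / M) by (apply Rinv_0_lt_compat, HM).
  assert (Hmin : 0 < Rmin (Rmin e1 e2) (/ M)) by (repeat apply Rmin_pos; assumption).
  assert (Heta1 : eta < e1).
  { pose proof (Rmin_l (Rmin e1 e2) (/ M)). pose proof (Rmin_l e1 e2). unfold eta. lra. }
  assert (Heta2 : eta < e2).
  { pose proof (Rmin_l (Rmin e1 e2) (/ M)). pose proof (Rmin_r e1 e2). unfold eta. lra. }
  assert (Heta3 : eta * M <= / 2).
  { pose proof (Rmin_r (Rmin e1 e2) (/ M)). replace (/ 2) with (/ M / 2 * M) by (field; lra).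
    apply Rmult_le_compat_r; unfold eta; lra. }
  assert (Heta : 0 < eta) by (unfold eta; lra).
  assert (Hbd : forall x, Rabs (x - x0) <= eta -> Rabs (f' x) <= M * Rabs (f x)).
  { intros x Hx. specialize (H1 x ltac:(lra)). specialize (H2 x ltac:(lra)).
    assert (HAx : Rabs (A x0) / 2 <= Rabs (A x)).
    { pose proof (Rabs_triang_inv (A x0) (A x)). rewrite <- Rabs_Ropp in H1.
      replace (- (A x - A x0)) with (A x0 - A x) in H1 by ring. lra. }
    assert (HBx : Rabs (B x) <= Rabs (B x0) + 1).
    { pose proof (Rabs_triang_inv (B x) (B x0)). lra. }
    assert (E : Rabs (A x) * Rabs (f' x) = Rabs (B x) * Rabs (f x)).
    { rewrite <- !Rabs_mult, <- (Rabs_Ropp (B x * f x)). f_equal.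
      specialize (Hode x). lra. }
    pose proof (Rabs_pos (f' x)). pose proof (Rabs_pos (f x)).
    apply (Rmult_le_reg_l (Rabs (A x0) / 2)); [lra|].
    replace (Rabs (A x0) / 2 * (M * Rabs (f x))) with ((Rabs (B x0) + 1) * Rabs (f x))
      by (unfold M; field; lra).
    nra. }
  assert (Hfc : continuity f) by exact (derivable_continuity f f' Hf).
  destruct (continuity_ab_maj (fun x => Rabs (f x)) (x0 - eta) (x0 + eta)) as [m [Hmax Hm]].
  { lra. }
  { intros x _. apply (continuity_pt_comp f Rabs); [apply Hfc|apply Rcontinuity_abs]. }
  assert (Hm0 : f m = 0).
  { destruct (MVT_gen f x0 m f') as [c [Hcm E]].
    - intros x _. apply is_derive_Reals, Hf.
    - intros x _. apply Hfc.
    - rewrite H0, Rminus_0_r in E.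
      assert (Hc1 : Rabs (c - x0) <= eta /\ Rabs (m - x0) <= eta).
      { revert Hcm. unfold Rmin, Rmax. split; apply Rabs_le;
          destruct (Rle_dec x0 m); lra. }
      destruct Hc1 as [Hc1 Hc2]. specialize (Hbd c Hc1).
      assert (Hcb : Rabs (f c) <= Rabs (f m)).
      { apply Hmax. apply Rabs_le_between in Hc1. lra. }
      assert (Hle : Rabs (f m) <= / 2 * Rabs (f m)).
      { rewrite E at 1. rewrite Rabs_mult.
        apply Rle_trans with (M * Rabs (f m) * eta).
        - apply Rmult_le_compat; try apply Rabs_pos; [|exact Hc2]. nra.
        - replace (M * Rabs (f m) * eta) with (eta * M * Rabs (f m)) by ring.
          apply Rmult_le_compat_r; [apply Rabs_pos|exact Heta3]. }
      destruct (Req_dec (f m) 0) as [Hz|Hz]; [exact Hz|].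
      pose proof (Rabs_pos_lt _ Hz). lra. }
  exists eta. split; [exact Heta|]. intros x Hx. apply Rabs_def2 in Hx.
  specialize (Hmax x ltac:(lra)). cbv beta in Hmax. rewrite Hm0, Rabs_R0 in Hmax.
  destruct (Req_dec (f x) 0) as [Hz|Hz]; [exact Hz|]. pose proof (Rabs_pos_lt _ Hz). lra.
Qed.

(** * Calculus on [R^d] *)

Definition C1_Rd (d : nat) (G : vec -> R) (dG : vec -> vec) : Prop :=
  (forall x i, inRd d x -> (i < d)%nat -> partial_at G x i (dG x i)) /\
  (forall i, (i < d)%nat -> cont_Rd d (fun x => dG x i)).

Lemma vadd_basis_basis (x : vec) (i : nat) (s t : R) :
  vadd (vadd x (vscal s (basis i))) (vscal t (basis i)) = vadd x (vscal (s + t) (basis i)).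
Proof. apply functional_extensionality. intros j. unfold vadd, vscal. ring. Qed.

Lemma vadd_scal0 (x u : vec) : vadd x (vscal 0 u) = x.
Proof. apply functional_extensionality. intros j. unfold vadd, vscal. ring. Qed.

Lemma partial_at_line (d : nat) (G : vec -> R) (g : vec -> R) (i : nat) (x : vec) (s : R) :
  (forall y, inRd d y -> partial_at G y i (g y)) -> inRd d x -> (i < d)%nat ->
  derivable_pt_lim (fun t => G (vadd x (vscal t (basis i)))) s
    (g (vadd x (vscal s (basis i)))).
Proof.
  intros HG Hx Hi eps Heps.
  destruct (HG (vadd x (vscal s (basis i))) ltac:(auto with inRd) eps Heps) as [del Hd].
  exists del. intros h Hh Hlt. generalize (Hd h Hh Hlt).
  rewrite !vadd_basis_basis. replace (s + (0 + h)) with (s + h) by ring.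
  replace (s + 0) with s by ring. auto.
Qed.

(** The path from [x] to [y] that changes one coordinate at a time. Each step is controlled by a
    single partial derivative, evaluated at a point no farther from [x] than [y] is. *)
Definition mix (m : nat) (y x : vec) : vec := fun i => if Nat.ltb i m then y i else x i.

Lemma frechet_step (d : nat) (G : vec -> R) (dG : vec -> vec) (x : vec) (m : nat) (eps : R) :
  C1_Rd d G dG -> inRd d x -> (m < d)%nat -> 0 < eps ->
  exists del, 0 < del /\ forall y, inRd d y -> vnorm d (vsub y x) < del ->
    Rabs (G (mix (S m) y x) - G (mix m y x) - dG x m * (y m - x m))
      <= eps * Rabs (y m - x m).
Proof.
  intros [HG HC] Hx Hm Heps. destruct (HC m Hm x Hx eps Heps) as [del [Hdel H]].
  exists del. split; [exact Hdel|]. intros y Hy Hyx.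
  set (p := mix m y x).
  assert (Hp : inRd d p).
  { intros i Hi. unfold p, mix. destruct (Nat.ltb i m); [apply Hy|apply Hx]; exact Hi. }
  set (f := fun t => G (vadd p (vscal t (basis m)))).
  assert (Hf : forall t, derivable_pt_lim f t (dG (vadd p (vscal t (basis m))) m)).
  { intros t. apply (partial_at_line d G (fun z => dG z m)); auto. }
  destruct (MVT_gen f 0 (y m - x m) (fun t => dG (vadd p (vscal t (basis m))) m))
    as [c [Hc E]].
  { intros t _. apply is_derive_Reals, Hf. }
  { intros t _. eapply derivable_pt_lim_cont, Hf. }
  assert (E1 : f (y m - x m) = G (mix (S m) y x)).
  { unfold f. f_equal. apply functional_extensionality. intros i.
    unfold vadd, vscal, p, mix, basis.
    destruct (Nat.ltb_spec i m), (Nat.ltb_spec i (S m)), (Nat.eqb_spec m i);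
      subst; try lia; try ring. }
  assert (E0 : f 0 = G p) by (unfold f; rewrite vadd_scal0; reflexivity).
  rewrite <- E1, <- E0, E.
  replace (dG (vadd p (vscal c (basis m))) m * (y m - x m - 0) - dG x m * (y m - x m))
    with ((dG (vadd p (vscal c (basis m))) m - dG x m) * (y m - x m)) by ring.
  rewrite Rabs_mult. apply Rmult_le_compat_r; [apply Rabs_pos|]. left.
  apply H; [auto with inRd|]. eapply Rle_lt_trans; [|exact Hyx]. apply vnorm_le.
  intros i Hi. unfold vsub, vadd, vscal, p, mix, basis.
  destruct (Nat.ltb_spec i m), (Nat.eqb_spec m i); subst; try lia.
  - right. f_equal. ring.
  - replace (x i + c * 1 - x i) with c by ring.
    revert Hc. unfold Rmin, Rmax, Rabs.
    destruct (Rle_dec 0 (y i - x i)), (Rcase_abs c), (Rcase_abs (y i - x i)); lra.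
  - replace (x i + c * 0 - x i) with 0 by ring. rewrite Rabs_R0. apply Rabs_pos.
Qed.

(** The steps along [mix] telescope, and each contributes its own coordinate difference to the
    error; this is why the error is measured in the l1 norm. *)
Lemma frechet (d : nat) (G : vec -> R) (dG : vec -> vec) (x : vec) (eps : R) :
  C1_Rd d G dG -> inRd d x -> 0 < eps ->
  exists del, 0 < del /\ forall y, inRd d y -> vnorm d (vsub y x) < del ->
    Rabs (G y - G x - dot d (dG x) (vsub y x)) <= eps * sumd d (fun i => Rabs (y i - x i)).
Proof.
  intros HG Hx Heps.
  assert (K : forall m, (m <= d)%nat -> exists del, 0 < del /\
    forall y, inRd d y -> vnorm d (vsub y x) < del ->
    Rabs (G (mix m y x) - G x - dot m (dG x) (vsub y x))
      <= eps * sumd m (fun i => Rabs (y i - x i))).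
  { induction m as [|m IH]; intros Hm.
    - exists 1. split; [lra|]. intros y _ _. unfold mix, dot. simpl.
      change (fun i : nat => x i) with x. rewrite Rminus_diag, Rminus_0_r, Rabs_R0. lra.
    - destruct IH as [d1 [Hd1 H1]]; [lia|].
      destruct (frechet_step d G dG x m eps HG Hx Hm Heps) as [d2 [Hd2 H2]].
      exists (Rmin d1 d2). split; [apply Rmin_pos; assumption|]. intros y Hy Hlt.
      specialize (H1 y Hy (Rlt_le_trans _ _ _ Hlt (Rmin_l _ _))).
      specialize (H2 y Hy (Rlt_le_trans _ _ _ Hlt (Rmin_r _ _))).
      unfold dot in *. simpl. unfold vsub in *.
      match goal with |- Rabs ?a <= _ =>
        replace a with ((G (mix m y x) - G x - sumd m (fun i => dG x i * (y i - x i)))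
          + (G (mix (S m) y x) - G (mix m y x) - dG x m * (y m - x m))) by ring end.
      eapply Rle_trans; [apply Rabs_triang|]. lra. }
  destruct (K d (Nat.le_refl d)) as [del [Hdel H]]. exists del. split; [exact Hdel|].
  intros y Hy Hlt. specialize (H y Hy Hlt).
  replace (mix d y x) with y in H; [exact H|].
  apply functional_extensionality. intros i. unfold mix.
  destruct (Nat.ltb_spec i d); [reflexivity|]. rewrite Hy, Hx by assumption. reflexivity.
Qed.

Lemma chain_rule (d : nat) (G : vec -> R) (dG : vec -> vec) (c : R -> vec) (t : R) (u : vec) :
  C1_Rd d G dG -> (forall s, inRd d (c s)) -> vderiv c t u ->
  derivable_pt_lim (fun s => G (c s)) t (dot d (dG (c t)) u).
Proof.
  intros HG Hc Hu.
  (* Convergent difference quotients are bounded, so [c] is Lipschitz at [t] in the l1 norm; this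
     converts the error of [frechet] into a multiple of [Rabs h]. *)
  assert (Hlip : forall m, exists K eta, 0 < K /\ 0 < eta /\ forall h, Rabs h < eta ->
     sumd m (fun i => Rabs (c (t + h) i - c t i)) <= K * Rabs h).
  { induction m as [|m [K [eta [HK [Heta H]]]]].
    - exists 1, 1. repeat split; try lra. intros h _. simpl. pose proof (Rabs_pos h). lra.
    - destruct (Hu m 1 Rlt_0_1) as [del Hd].
      exists (K + (Rabs (u m) + 1)), (Rmin eta del). pose proof (Rabs_pos (u m)).
      split; [lra|]. split; [apply Rmin_pos; [exact Heta|apply cond_pos]|].
      intros h Hh. simpl. rewrite Rmult_plus_distr_r. apply Rplus_le_compat.
      { apply H. eapply Rlt_le_trans; [exact Hh|apply Rmin_l]. }
      destruct (Req_dec h 0) as [->|Hne].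
      { rewrite Rplus_0_r, Rminus_diag, Rabs_R0. lra. }
      specialize (Hd h Hne (Rlt_le_trans _ _ _ Hh (Rmin_r _ _))).
      replace (c (t + h) m - c t m) with
        (((c (t + h) m - c t m) / h - u m + u m) * h) by (field; exact Hne).
      rewrite Rabs_mult. apply Rmult_le_compat_r; [apply Rabs_pos|].
      eapply Rle_trans; [apply Rabs_triang|]. lra. }
  destruct (Hlip d) as [K [eta [HK [Heta HL]]]].
  assert (Hdot : derivable_pt_lim (fun s => dot d (dG (c t)) (c s)) t (dot d (dG (c t)) u)).
  { eapply derivable_pt_lim_value.
    - apply (derivable_pt_lim_dot d (fun _ => dG (c t)) c); [apply vderiv_const|exact Hu].
    - rewrite dot_comm, dot_zero_r. ring. }
  intros eps Heps.
  destruct (Hdot (eps / 2) ltac:(lra)) as [d1 Hd1].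
  (* With Lipschitz constant [K] the nonlinear error is at most [eps / 4] times [Rabs h]; the linear
     part takes [eps / 2]. *)
  assert (He2 : 0 < eps / (4 * K)) by (apply Rdiv_lt_0_compat; lra).
  destruct (frechet d G dG (c t) _ HG (Hc t) He2) as [d2 [Hd2 HF]].
  assert (Hm : 0 < Rmin (Rmin d1 eta) (d2 / K)).
  { repeat apply Rmin_pos; try apply cond_pos; try exact Heta.
    apply Rdiv_lt_0_compat; assumption. }
  exists (mkposreal _ Hm). simpl. intros h Hne Hh.
  assert (Hh1 : Rabs h < d1).
  { eapply Rlt_le_trans; [exact Hh|]. eapply Rle_trans; apply Rmin_l. }
  assert (Hh2 : Rabs h < eta).
  { eapply Rlt_le_trans; [exact Hh|]. eapply Rle_trans; [apply Rmin_l|apply Rmin_r]. }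
  assert (Hh3 : K * Rabs h < d2).
  { assert (Rabs h < d2 / K) by (eapply Rlt_le_trans; [exact Hh|apply Rmin_r]).
    replace d2 with (K * (d2 / K)) by (field; lra). apply Rmult_lt_compat_l; assumption. }
  specialize (Hd1 h Hne Hh1). specialize (HL h Hh2).
  specialize (HF (c (t + h)) (Hc _)
    ltac:(eapply Rle_lt_trans; [apply vnorm_le_sum|eapply Rle_lt_trans; [exact HL|exact Hh3]])).
  assert (Hpos : 0 < Rabs h) by (apply Rabs_pos_lt; exact Hne).
  replace (dot d (dG (c t)) (vsub (c (t + h)) (c t)))
    with (dot d (dG (c t)) (c (t + h)) - dot d (dG (c t)) (c t)) in HF.
  2: { unfold dot. replace (sumd d (fun i => dG (c t) i * c (t + h) i) -
         sumd d (fun i => dG (c t) i * c t i)) with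
         (sumd d (fun i => dG (c t) i * c (t + h) i) +
           (-1) * sumd d (fun i => dG (c t) i * c t i)) by ring.
       rewrite <- sumd_scal, <- sumd_plus. apply sumd_ext. intros. unfold vsub. ring. }
  set (A := G (c (t + h)) - G (c t)) in *.
  set (D := dot d (dG (c t)) (c (t + h)) - dot d (dG (c t)) (c t)) in *.
  replace (A / h - dot d (dG (c t)) u)
    with ((A - D) / h + (D / h - dot d (dG (c t)) u)) by (field; exact Hne).
  eapply Rle_lt_trans; [apply Rabs_triang|].
  assert (Rabs ((A - D) / h) <= eps / 4); [|lra].
  unfold Rdiv at 1. rewrite Rabs_mult, Rabs_inv.
  apply (Rmult_le_reg_r (Rabs h)); [exact Hpos|].
  rewrite Rmult_assoc, Rinv_l, Rmult_1_r by lra.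
  eapply Rle_trans; [exact HF|].
  replace (eps / 4 * Rabs h) with (eps / (4 * K) * (K * Rabs h)) by (field; lra).
  apply Rmult_le_compat_l; [lra|exact HL].
Qed.

Lemma sumd_basis (d i : nat) : (i < d)%nat -> sumd d (basis i) = 1.
Proof.
  induction d as [|d IH]; intros Hi; [lia|]. simpl. unfold basis at 2.
  destruct (Nat.eqb_spec i d) as [->|Hne]; [|rewrite IH by lia; ring].
  rewrite (sumd_ext d _ (fun _ => 0)), sumd_zero; [ring|].
  intros j Hj. unfold basis. destruct (Nat.eqb_spec d j); [lia|reflexivity].
Qed.

Lemma cont_Rd_plane (d : nat) (G : vec -> R) (x : vec) (i j : nat) :
  cont_Rd d G -> inRd d x -> (i < d)%nat -> (j < d)%nat ->
  continuity_2d_pt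
    (fun u v => G (vadd (vadd x (vscal u (basis i))) (vscal v (basis j)))) 0 0.
Proof.
  intros HG Hx Hi Hj eps. destruct (HG x Hx eps (cond_pos eps)) as [del [Hdel H]].
  assert (H2 : 0 < del / 2) by lra.
  exists (mkposreal _ H2). simpl. intros u v Hu Hv. rewrite Rminus_0_r in Hu, Hv.
  rewrite !vadd_scal0. apply H; [auto with inRd|].
  eapply Rle_lt_trans; [apply vnorm_le_sum|].
  apply Rle_lt_trans with (Rabs u * sumd d (basis i) + Rabs v * sumd d (basis j)).
  - rewrite <- !sumd_scal, <- sumd_plus. apply sumd_le. intros m _.
    unfold vsub, vadd, vscal, basis.
    replace (x m + u * (if Nat.eqb i m then 1 else 0) + v * (if Nat.eqb j m then 1 else 0) - x m)
      with (u * (if Nat.eqb i m then 1 else 0) + v * (if Nat.eqb j m then 1 else 0)) by ring.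
    eapply Rle_trans; [apply Rabs_triang|]. rewrite !Rabs_mult.
    destruct (Nat.eqb i m), (Nat.eqb j m); rewrite ?Rabs_R0, ?Rabs_R1; lra.
  - rewrite !sumd_basis by assumption. lra.
Qed.

(** Restricting [F] to the parameters [(u, v)] of [x + u basis i + v basis j] reduces the claim to
    the two-variable theorem [Schwarz]. *)
Lemma hessian_sym (d : nat) (F : vec -> R) (g : vec -> vec) (h : vec -> nat -> nat -> R) :
  (forall x i, inRd d x -> (i < d)%nat -> partial_at F x i (g x i)) ->
  (forall x i j, inRd d x -> (i < d)%nat -> (j < d)%nat ->
     partial_at (fun y => g y j) x i (h x i j)) ->
  (forall i j, (i < d)%nat -> (j < d)%nat -> cont_Rd d (fun x => h x i j)) ->
  forall x i j, inRd d x -> (i < d)%nat -> (j < d)%nat -> h x i j = h x j i.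
Proof.
  intros HF Hg Hc x i j Hx Hi Hj.
  set (pt := fun u v => vadd (vadd x (vscal u (basis i))) (vscal v (basis j))).
  assert (Hpt : forall u v, pt u v = vadd (vadd x (vscal v (basis j))) (vscal u (basis i))).
  { intros u v. apply functional_extensionality. intros m. unfold pt, vadd, vscal. ring. }
  assert (Hin : forall u v, inRd d (pt u v)) by (intros; unfold pt; auto with inRd).
  assert (Dv : forall (G : vec -> R) (q : vec -> R),
    (forall y, inRd d y -> partial_at G y j (q y)) ->
    forall u v, is_derive (fun t => G (pt u t)) v (q (pt u v))).
  { intros G q HG u v. apply is_derive_Reals.
    apply (partial_at_line d G q j (vadd x (vscal u (basis i)))); auto with inRd. }
  assert (Du : forall (G : vec -> R) (q : vec -> R),
    (forall y, inRd d y -> partial_at G y i (q y)) ->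
    forall u v, is_derive (fun t => G (pt t v)) u (q (pt u v))).
  { intros G q HG u v. apply is_derive_Reals. rewrite Hpt.
    apply (derivable_pt_lim_eqf
      (fun t => G (vadd (vadd x (vscal v (basis j))) (vscal t (basis i))))).
    - intros t. rewrite Hpt. reflexivity.
    - apply (partial_at_line d G q i); auto with inRd. }
  assert (Ev : forall u v, Derive (fun t => F (pt u t)) v = g (pt u v) j).
  { intros u v. apply is_derive_unique, (Dv F (fun y => g y j)). auto. }
  assert (Eu : forall u v, Derive (fun t => F (pt t v)) u = g (pt u v) i).
  { intros u v. apply is_derive_unique, (Du F (fun y => g y i)). auto. }
  assert (Euv : forall u v,
    is_derive (fun z => Derive (fun t => F (pt z t)) v) u (h (pt u v) i j)).
  { intros u v. apply (is_derive_ext (fun z => g (pt z v) j)).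
    - intros z. symmetry. apply Ev.
    - apply (Du (fun y => g y j) (fun y => h y i j)). auto. }
  assert (Evu : forall u v,
    is_derive (fun z => Derive (fun t => F (pt t z)) u) v (h (pt u v) j i)).
  { intros u v. apply (is_derive_ext (fun z => g (pt u z) i)).
    - intros z. symmetry. apply Eu.
    - apply (Dv (fun y => g y i) (fun y => h y j i)). auto. }
  assert (E0 : pt 0 0 = x) by (unfold pt; rewrite !vadd_scal0; reflexivity).
  rewrite <- E0 at 1. rewrite <- (is_derive_unique _ _ _ (Euv 0 0)).
  rewrite <- E0. rewrite <- (is_derive_unique _ _ _ (Evu 0 0)).
  apply (Schwarz (fun u v => F (pt u v)) 0 0).
  - exists (mkposreal 1 Rlt_0_1). intros u v _ _. repeat split; eexists.
    + apply (Du F (fun y => g y i)). auto.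
    + apply (Dv F (fun y => g y j)). auto.
    + apply Euv.
    + apply Evu.
  - apply (continuity_2d_pt_ext (fun u v => h (pt u v) i j)).
    + intros u v. symmetry. apply is_derive_unique, Euv.
    + apply (cont_Rd_plane d (fun y => h y i j)); auto.
  - apply (continuity_2d_pt_ext (fun u v => h (pt u v) j i)).
    + intros u v. symmetry. apply is_derive_unique, Evu.
    + apply (cont_Rd_plane d (fun y => h y j i)); auto.
Qed.

(** * The hypersurface and its normal *)

Lemma cont_Rd_ext (d : nat) (G H : vec -> R) :
  (forall x, inRd d x -> G x = H x) -> cont_Rd d G -> cont_Rd d H.
Proof.
  intros E HG x Hx eps Heps. destruct (HG x Hx eps Heps) as [del [Hdel HH]].
  exists del. split; [exact Hdel|]. intros y Hy Hlt. rewrite <- !E by assumption. auto.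
Qed.

Lemma partial_at_unique (d : nat) (G H : vec -> R) (x : vec) (i : nat) (g h : R) :
  (forall y, inRd d y -> G y = H y) -> inRd d x -> (i < d)%nat ->
  partial_at G x i g -> partial_at H x i h -> g = h.
Proof.
  intros E Hx Hi HG HH.
  apply (uniqueness_limite (fun t => G (vadd x (vscal t (basis i)))) 0); [exact HG|].
  refine (derivable_pt_lim_eqf _ _ _ _ _ HH). intros t. symmetry. apply E. auto with inRd.
Qed.

(** [hessF] carries no information for indices from [d] on; the test gives those coordinates the
    derivative 0 that [gradF] has there. *)
Definition hess_app (d : nat) (hessF : vec -> nat -> nat -> R) (x u : vec) : vec :=
  fun j => if Nat.ltb j d then sumd d (fun i => hessF x i j * u i) else 0.

(** The quotient rule for [- gradF / |gradF|] in the direction [u]; on tangent vectors this is minus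
    the shape operator for the inner normal. *)
Definition dnormal (d : nat) (gradF : vec -> vec) (hessF : vec -> nat -> nat -> R)
    (x u : vec) : vec :=
  vadd (vscal (dot d (gradF x) (hess_app d hessF x u) / (vnorm d (gradF x)) ^ 3) (gradF x))
       (vscal (- / vnorm d (gradF x)) (hess_app d hessF x u)).

Section Hypersurface.
Context (d : nat) (F : vec -> R) (gradF : vec -> vec) (hessF : vec -> nat -> nat -> R)
  (HS : strictly_convex_hypersurface d F gradF hessF).

Local Notation normal := (inner_normal d gradF).
Local Notation dn := (dnormal d gradF hessF).

Lemma gradF_inRd (x : vec) : inRd d x -> inRd d (gradF x).
Proof. apply HS. Qed.

Lemma gradF_pos (x : vec) : onS d F x -> 0 < vnorm d (gradF x).
Proof. intros [Hx H0]. destruct HS as (_ & _ & _ & _ & H & _). auto. Qed.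

(** Smoothness speaks of an abstract family [D] of partial derivatives. Uniqueness of derivatives
    identifies its members of order one and two with [gradF] and [hessF], which thereby inherit
    continuity. *)
Lemma hypersurface_C2 :
  C1_Rd d F gradF /\
  (forall j, (j < d)%nat -> C1_Rd d (fun x => gradF x j) (fun x i => hessF x i j)) /\
  (forall x i j, inRd d x -> (i < d)%nat -> (j < d)%nat -> hessF x i j = hessF x j i).
Proof.
  destruct HS as ((D & H0 & Hc & HD) & _ & Hg & Hh & _).
  assert (E1 : forall x i, inRd d x -> (i < d)%nat -> D (i :: nil) x = gradF x i).
  { intros x i Hx Hi.
    apply (partial_at_unique d (D nil) F x i); auto. apply HD; assumption. }
  assert (E2 : forall x i j, inRd d x -> (i < d)%nat -> (j < d)%nat ->
    D (i :: j :: nil) x = hessF x i j).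
  { intros x i j Hx Hi Hj.
    apply (partial_at_unique d (D (j :: nil)) (fun y => gradF y j) x i); auto.
    apply HD; assumption. }
  assert (C2 : forall i j, (i < d)%nat -> (j < d)%nat -> cont_Rd d (fun x => hessF x i j)).
  { intros i j Hi Hj. apply (cont_Rd_ext d (D (i :: j :: nil))); auto. }
  split; [|split].
  - split; [assumption|]. intros i Hi. apply (cont_Rd_ext d (D (i :: nil))); auto.
  - intros j Hj. split; auto.
  - exact (hessian_sym d F gradF hessF Hg Hh C2).
Qed.

Lemma normal_inRd (x : vec) : inRd d x -> inRd d (normal x).
Proof. intros Hx. apply inRd_scal, gradF_inRd, Hx. Qed.

Lemma dot_gradF (x u : vec) : onS d F x ->
  dot d u (gradF x) = - vnorm d (gradF x) * dot d u (normal x).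
Proof.
  intros Hx. pose proof (gradF_pos x Hx). unfold inner_normal. rewrite dot_scal_r.
  field. lra.
Qed.

Lemma normal_unit (x : vec) : onS d F x -> dot d (normal x) (normal x) = 1.
Proof.
  intros Hx. pose proof (gradF_pos x Hx). unfold inner_normal.
  rewrite dot_scal_l, dot_scal_r, <- vnorm_sq. field. lra.
Qed.

Lemma derivable_pt_lim_F (c : R -> vec) (t : R) (u : vec) :
  (forall s, inRd d (c s)) -> vderiv c t u ->
  derivable_pt_lim (fun s => F (c s)) t (dot d u (gradF (c t))).
Proof.
  intros Hc Hu. rewrite dot_comm. apply chain_rule; [apply hypersurface_C2|exact Hc|exact Hu].
Qed.

Lemma vderiv_gradF (c : R -> vec) (t : R) (u : vec) :
  (forall s, inRd d (c s)) -> vderiv c t u ->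
  vderiv (fun s => gradF (c s)) t (hess_app d hessF (c t) u).
Proof.
  intros Hc Hu j. unfold hess_app. destruct (Nat.ltb_spec j d) as [Hj|Hj].
  - apply (chain_rule d (fun x => gradF x j) (fun x i => hessF x i j)); auto.
    apply hypersurface_C2, Hj.
  - apply (derivable_pt_lim_eqf (fun _ => 0)); [|apply derivable_pt_lim_const].
    intros s. symmetry. apply gradF_inRd; [apply Hc|exact Hj].
Qed.

Lemma vderiv_normal (c : R -> vec) (t : R) (u : vec) :
  (forall s, inRd d (c s)) -> onS d F (c t) -> vderiv c t u ->
  vderiv (fun s => normal (c s)) t (dn (c t) u).
Proof.
  intros Hc Hon Hu. pose proof (gradF_pos _ Hon) as Hp.
  pose proof (vderiv_gradF c t u Hc Hu) as Hg.
  pose proof (derivable_pt_lim_dot d _ _ _ _ _ Hg Hg) as Hgg.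
  assert (Hgg0 : 0 < dot d (gradF (c t)) (gradF (c t))) by (rewrite <- vnorm_sq; nra).
  pose proof (derivable_pt_lim_comp _ _ _ _ _ Hgg (derivable_pt_lim_sqrt _ Hgg0)) as Hn.
  assert (Hi : derivable_pt_lim (fun s => / vnorm d (gradF (c s))) t
    (- (dot d (gradF (c t)) (hess_app d hessF (c t) u) / vnorm d (gradF (c t)))
      / vnorm d (gradF (c t)) ^ 2)).
  { apply is_derive_Reals, is_derive_inv; [|lra]. apply is_derive_Reals.
    refine (derivable_pt_lim_value _ _ _ _ Hn _).
    rewrite (dot_comm d (hess_app d hessF (c t) u) (gradF (c t))).
    change (sqrt (dot d (gradF (c t)) (gradF (c t)))) with (vnorm d (gradF (c t))).
    field. lra. }
  pose proof (vderiv_scal _ _ _ _ _ (derivable_pt_lim_opp _ _ _ Hi) Hg) as HH.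
  refine (vderiv_value _ _ _ _ HH _). intros i. clear -Hp.
  unfold dnormal, vadd, vscal, opp_fct. field. lra.
Qed.

Lemma normal_dnormal (x u : vec) : onS d F x -> dot d (normal x) (dn x u) = 0.
Proof.
  intros Hx. pose proof (gradF_pos x Hx). unfold inner_normal, dnormal.
  rewrite dot_scal_l, dot_add_r, !dot_scal_r, <- vnorm_sq. field. lra.
Qed.

(** Tangency of [y] kills the gradient term of [dnormal], leaving minus the second fundamental form
    of [u] and [y]. *)
Lemma dot_dnormal (x u y : vec) : onS d F x -> dot d y (normal x) = 0 ->
  dot d y (dn x u)
  = - / vnorm d (gradF x) * sumd d (fun i => sumd d (fun j => hessF x i j * u i * y j)).
Proof.
  intros Hx Hy. pose proof (gradF_pos x Hx). unfold dnormal.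
  rewrite dot_add_r, !dot_scal_r, (dot_gradF x y Hx), Hy, sumd_exchange.
  replace (dot d y (hess_app d hessF x u))
    with (sumd d (fun j => sumd d (fun i => hessF x i j * u i * y j))); [ring|].
  apply sumd_ext. intros j Hj. unfold hess_app.
  destruct (Nat.ltb_spec j d); [|lia].
  rewrite <- sumd_scal. apply sumd_ext. intros; ring.
Qed.

Lemma dnormal_sym (x u y : vec) : onS d F x ->
  dot d u (normal x) = 0 -> dot d y (normal x) = 0 ->
  dot d y (dn x u) = dot d u (dn x y).
Proof.
  intros Hx Hu Hy. rewrite !dot_dnormal by assumption. f_equal.
  rewrite sumd_exchange. apply sumd_ext. intros i Hi. apply sumd_ext. intros j Hj.
  rewrite (proj2 (proj2 hypersurface_C2) x i j (proj1 Hx) Hi Hj). ring.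
Qed.

Lemma tangent_of_level (c : R -> vec) (t eta : R) (u : vec) :
  (forall s, inRd d (c s)) -> 0 < eta ->
  (forall s, Rabs (s - t) < eta -> F (c s) = 0) -> vderiv c t u ->
  dot d u (normal (c t)) = 0.
Proof.
  intros Hc Heta H0 Hu.
  assert (Hon : onS d F (c t)).
  { split; [apply Hc|]. apply H0. rewrite Rminus_diag, Rabs_R0. exact Heta. }
  pose proof (derivable_pt_lim_F c t u Hc Hu) as HF.
  apply (derivable_pt_lim_local _ (fun _ => 0) _ _ eta Heta H0) in HF.
  pose proof (uniqueness_limite _ _ _ _ HF (derivable_pt_lim_const 0 t)) as E.
  rewrite (dot_gradF _ _ Hon) in E. pose proof (gradF_pos _ Hon). nra.
Qed.

(** Along the lines of slope [m + eps] and [m - eps] through [r0], the values of [F] have nonzero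
    derivatives of opposite sign at [t0]. The intermediate value theorem in [r] therefore puts a
    root within [eps * Rabs h] of the tangent line, which is what [derivable_selection] asks for. *)
Lemma implicit_root (P Z : R -> vec) (t0 r0 : R) (P' Z' : vec) :
  (forall t, inRd d (P t)) -> (forall t, inRd d (Z t)) ->
  vderiv P t0 P' -> vderiv Z t0 Z' ->
  F (vadd (P t0) (vscal r0 (Z t0))) = 0 ->
  dot d (Z t0) (gradF (vadd (P t0) (vscal r0 (Z t0)))) <> 0 ->
  exists rho rho' eta, 0 < eta /\ rho t0 = r0 /\ derivable_pt_lim rho t0 rho' /\
    forall t, Rabs (t - t0) < eta -> F (vadd (P t) (vscal (rho t) (Z t))) = 0.
Proof.
  intros HP HZ HdP HdZ H0 Htr.
  set (g := gradF (vadd (P t0) (vscal r0 (Z t0)))) in *.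
  (* The slope for which the derivative of [F] along [P + r Z] vanishes at [t0]; transversality
     makes the denominator nonzero. *)
  set (m := - (dot d P' g + r0 * dot d Z' g) / dot d (Z t0) g).
  assert (Hline : forall mu, derivable_pt_lim
    (fun t => F (vadd (P t) (vscal (r0 + mu * (t - t0)) (Z t)))) t0
    ((mu - m) * dot d (Z t0) g)).
  { intros mu.
    assert (Hr : derivable_pt_lim (fun t => r0 + mu * (t - t0)) t0 mu).
    { apply is_derive_Reals. auto_derive; [exact I|ring]. }
    pose proof (derivable_pt_lim_F (fun t => vadd (P t) (vscal (r0 + mu * (t - t0)) (Z t)))
      t0 _ ltac:(intros; cbv beta; auto with inRd) (vderiv_add _ _ _ _ _ HdP (vderiv_scal _ _ _ _ _ Hr HdZ))) as HH.
    cbv beta in HH. replace (r0 + mu * (t0 - t0)) with r0 in HH by ring. fold g in HH.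
    refine (derivable_pt_lim_value _ _ _ _ HH _).
    rewrite !dot_add_l, !dot_scal_l. unfold m. field. exact Htr. }
  destruct (derivable_selection
    (fun t r => F (vadd (P t) (vscal r (Z t))) = 0) t0 r0 m H0) as (rho & eta & H).
  2: { exists rho, m, eta. exact H. }
  intros eps Heps.
  assert (Hsg : forall mu, mu <> m -> exists eta, 0 < eta /\ forall h, h <> 0 ->
    Rabs h < eta -> 0 < F (vadd (P (t0 + h)) (vscal (r0 + mu * h) (Z (t0 + h)))) *
      ((mu - m) * dot d (Z t0) g) * h).
  { intros mu Hmu.
    destruct (derivable_pt_lim_sign
      (fun t => F (vadd (P t) (vscal (r0 + mu * (t - t0)) (Z t)))) t0
      ((mu - m) * dot d (Z t0) g)) as [eta [He Hs]].
    - replace (r0 + mu * (t0 - t0)) with r0 by ring. exact H0.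
    - apply Hline.
    - apply Rmult_integral_contrapositive_currified; [lra|exact Htr].
    - exists eta. split; [exact He|]. intros h Hh Hlt. specialize (Hs h Hh Hlt).
      replace (t0 + h - t0) with h in Hs by ring. exact Hs. }
  destruct (Hsg (m + eps) ltac:(lra)) as [e1 [He1 H1]].
  destruct (Hsg (m - eps) ltac:(lra)) as [e2 [He2 H2]].
  exists (Rmin e1 e2). split; [apply Rmin_pos; assumption|]. intros h Hne Hh.
  specialize (H1 h Hne (Rlt_le_trans _ _ _ Hh (Rmin_l _ _))).
  specialize (H2 h Hne (Rlt_le_trans _ _ _ Hh (Rmin_r _ _))).
  set (f := fun r => F (vadd (P (t0 + h)) (vscal r (Z (t0 + h))))).
  assert (Hf : continuity f).
  { intros r. eapply derivable_pt_lim_cont.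
    apply (derivable_pt_lim_F (fun r => vadd (P (t0 + h)) (vscal r (Z (t0 + h)))));
      [intros; cbv beta; auto with inRd|].
    apply vderiv_add; [apply vderiv_const|].
    apply (vderiv_scal (fun r => r)); [apply derivable_pt_lim_id|apply vderiv_const]. }
  destruct (IVT_gen f (r0 + (m + eps) * h) (r0 + (m - eps) * h) 0 Hf) as [r [Hr E]].
  - change (F (vadd (P (t0 + h)) (vscal (r0 + (m + eps) * h) (Z (t0 + h)))))
      with (f (r0 + (m + eps) * h)) in H1.
    change (F (vadd (P (t0 + h)) (vscal (r0 + (m - eps) * h) (Z (t0 + h)))))
      with (f (r0 + (m - eps) * h)) in H2.
    set (x := f (r0 + (m + eps) * h)) in *. set (y := f (r0 + (m - eps) * h)) in *.
    set (D := dot d (Z t0) g) in *.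
    (* The product of the two sign conditions is minus [x * y] times a square, so [x] and [y] have
       opposite signs. *)
    assert (K : 0 < - (x * y) * ((eps * D * h) * (eps * D * h))).
    { replace (- (x * y) * ((eps * D * h) * (eps * D * h))) with
        ((x * ((m + eps - m) * D) * h) * (y * ((m - eps - m) * D) * h)) by ring.
      apply Rmult_lt_0_compat; assumption. }
    assert (x * y < 0).
    { apply Rnot_le_lt. intros Hle. pose proof (Rle_0_sqr (eps * D * h)) as Hq.
      unfold Rsqr in Hq. nra. }
    unfold Rmin, Rmax. destruct (Rle_dec x y); split; nra.
  - exists r. split; [exact E|]. revert Hr. clear - Heps. unfold Rmin, Rmax, Rabs.
    destruct (Rle_dec (r0 + (m + eps) * h) (r0 + (m - eps) * h)),
      (Rcase_abs (r - (r0 + m * h))), (Rcase_abs h); intros; nra.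
Qed.

Lemma chord_inside (p z : vec) (l r : R) :
  onS d F p -> onS d F (vadd p (vscal l z)) -> 0 < l -> 0 <= r <= l ->
  F (vadd p (vscal r z)) <= 0.
Proof.
  intros [Hp Hp0] [Hq Hq0] Hl Hr. destruct HS as (_ & _ & _ & _ & _ & _ & Hconv & _).
  replace (vadd p (vscal r z)) with
    (vadd (vscal (1 - r / l) p) (vscal (r / l) (vadd p (vscal l z)))).
  - apply Hconv; try assumption; try lra. split.
    + apply Rmult_le_pos; [lra|]. left. apply Rinv_0_lt_compat, Hl.
    + apply (Rmult_le_reg_r l); [exact Hl|]. unfold Rdiv. rewrite Rmult_assoc, Rinv_l by lra. lra.
  - apply functional_extensionality. intros i. unfold vadd, vscal. field. lra.
Qed.

Lemma derivable_pt_lim_ray (p z : vec) (r : R) : inRd d p -> inRd d z ->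
  derivable_pt_lim (fun r => F (vadd p (vscal r z))) r (dot d z (gradF (vadd p (vscal r z)))).
Proof.
  intros Hp Hz. apply (derivable_pt_lim_F (fun r => vadd p (vscal r z))); [intros; cbv beta; auto with inRd|].
  intros i. unfold vadd, vscal. apply is_derive_Reals. auto_derive; [exact I|ring].
Qed.

(** * Consequences of the Gutkin property for single chords and their variations *)

Context (delta : R) (Hdelta : 0 < delta < PI / 2) (HG : gutkin d F gradF delta).

Lemma sin_cos_delta_pos : 0 < sin delta /\ 0 < cos delta.
Proof. split; [apply sin_gt_0|apply cos_gt_0]; lra. Qed.

(** [asin] is total and takes the values -PI/2 and PI/2 outside the open interval (-1, 1); the
    strict bounds on [delta] exclude these cases. *)
Lemma asin_eq_delta (x : R) : asin x = delta -> x = sin delta.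
Proof.
  intros E. destruct (Rle_dec x (-1)) as [H1|H1].
  - unfold asin in E. destruct (Rle_dec x (-1)); [lra|contradiction].
  - destruct (Rle_dec 1 x) as [H2|H2].
    + unfold asin in E. destruct (Rle_dec x (-1)); [contradiction|].
      destruct (Rle_dec 1 x); [lra|contradiction].
    + rewrite <- E, sin_asin; lra.
Qed.

(* Convexity makes the chord leave the domain at its far end, which fixes the sign
   that the unoriented angle in the Gutkin property leaves open. *)
Lemma chord_end_angle (p z : vec) (l : R) :
  onS d F p -> inRd d z -> 0 < vnorm d z -> dot d z (normal p) = sin delta * vnorm d z ->
  0 < l -> onS d F (vadd p (vscal l z)) ->
  dot d z (normal (vadd p (vscal l z))) = - sin delta * vnorm d z.
Proof.
  intros Hp Hz Hz0 Hang Hl Hq. set (q := vadd p (vscal l z)) in *.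
  destruct sin_cos_delta_pos as [Hs Hc].
  assert (Hqp : vsub q p = vscal l z).
  { apply functional_extensionality. intros i. unfold vsub, q, vadd, vscal. ring. }
  assert (Habs : forall x, angle_hyp d (vsub q p) x = asin (Rabs (dot d z x) / vnorm d z)).
  { intros x. unfold angle_hyp. rewrite Hqp, dot_scal_l, vnorm_scal by lra.
    rewrite Rabs_mult, (Rabs_right l) by lra. f_equal. field. lra. }
  assert (E : Rabs (dot d z (normal q)) / vnorm d z = sin delta).
  { apply asin_eq_delta. rewrite <- Habs. apply HG; try assumption.
    - rewrite Hqp, vnorm_scal by lra. nra.
    - rewrite Habs, Hang, Rabs_right by nra.
      replace (sin delta * vnorm d z / vnorm d z) with (sin delta) by (field; lra).
      apply asin_sin. lra. }
  assert (Hneg : dot d z (normal q) <= 0).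
  { apply Rnot_lt_le. intros Hpos.
    assert (HD : dot d z (gradF q) < 0).
    { rewrite (dot_gradF q z Hq). pose proof (gradF_pos q Hq). nra. }
    destruct (derivable_pt_lim_sign _ _ _ (proj2 Hq : (fun r => F (vadd p (vscal r z))) l = 0)
      (derivable_pt_lim_ray p z l (proj1 Hp) Hz)) as [eta [Heta Hsg]]; [fold q; lra|].
    fold q in Hsg. set (h := Rmin (eta / 2) l).
    assert (Hh : 0 < h) by (apply Rmin_pos; lra).
    assert (Hh1 : h <= eta / 2) by apply Rmin_l. assert (Hh2 : h <= l) by apply Rmin_r.
    specialize (Hsg (- h) ltac:(lra)). rewrite Rabs_Ropp, Rabs_right in Hsg by lra.
    specialize (Hsg ltac:(lra)).
    assert (F (vadd p (vscal (l + - h) z)) <= 0) by (apply (chord_inside p z l); auto; lra).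
    assert (0 < dot d z (gradF q) * - h) by nra. nra. }
  rewrite Rabs_left1 in E by exact Hneg.
  assert (- dot d z (normal q) = sin delta * vnorm d z) by (rewrite <- E; field; lra). lra.
Qed.

(** By [chord_end_angle] the direction [z] points strictly outwards at the nearer end, so points
    just beyond it lie outside the domain, while convexity with the farther end puts them inside. *)
Lemma chord_length_unique (p z : vec) (l1 l2 : R) :
  onS d F p -> inRd d z -> 0 < vnorm d z -> dot d z (normal p) = sin delta * vnorm d z ->
  0 < l1 -> onS d F (vadd p (vscal l1 z)) -> 0 < l2 -> onS d F (vadd p (vscal l2 z)) ->
  l1 = l2.
Proof.
  intros Hp Hz Hz0 Hang.
  assert (K : forall l1 l2, 0 < l1 -> onS d F (vadd p (vscal l1 z)) ->
    0 < l2 -> onS d F (vadd p (vscal l2 z)) -> l1 < l2 -> False).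
  { clear l1 l2. intros l1 l2 H1 Hq1 H2 Hq2 Hlt. destruct sin_cos_delta_pos as [Hs Hc].
    pose proof (chord_end_angle p z l1 Hp Hz Hz0 Hang H1 Hq1) as HN.
    assert (HD : 0 < dot d z (gradF (vadd p (vscal l1 z)))).
    { rewrite (dot_gradF _ z Hq1), HN. pose proof (gradF_pos _ Hq1).
      assert (0 < sin delta * vnorm d z) by nra. nra. }
    destruct (derivable_pt_lim_sign _ _ _ (proj2 Hq1 : (fun r => F (vadd p (vscal r z))) l1 = 0)
      (derivable_pt_lim_ray p z l1 (proj1 Hp) Hz)) as [eta [Heta Hsg]]; [lra|].
    set (h := Rmin (eta / 2) (l2 - l1)).
    assert (Hh : 0 < h) by (apply Rmin_pos; lra).
    assert (Hh1 : h <= eta / 2) by apply Rmin_l.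
    assert (Hh2 : h <= l2 - l1) by apply Rmin_r.
    specialize (Hsg h ltac:(lra)). rewrite Rabs_right in Hsg by lra.
    specialize (Hsg ltac:(lra)).
    assert (F (vadd p (vscal (l1 + h) z)) <= 0) by (apply (chord_inside p z l2); auto; lra).
    assert (0 < dot d z (gradF (vadd p (vscal l1 z))) * h) by nra. nra. }
  intros H1 Hq1 H2 Hq2. destruct (Rtotal_order l1 l2) as [?|[?|?]]; [|assumption|];
    exfalso; eauto.
Qed.

(* Infinitesimal form of the Gutkin property. The varied direction is
   [y + r n], [y := z + t zeta], with [r] chosen so that the angle at the foot of
   the chord is exactly [delta]; the first-order conditions give [r' 0 = 0]. *)
Lemma chord_variation (p z dp zeta : vec) (l m : R) :
  onS d F p -> inRd d z -> dot d z z = 1 -> dot d z (normal p) = sin delta ->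
  0 < l -> onS d F (vadd p (vscal l z)) ->
  inRd d dp -> dot d dp (normal p) = 0 ->
  inRd d zeta -> dot d zeta z = 0 -> dot d zeta (normal p) + dot d z (dn p dp) = 0 ->
  dot d (vadd dp (vadd (vscal m z) (vscal l zeta))) (normal (vadd p (vscal l z))) = 0 ->
  dot d zeta (normal (vadd p (vscal l z)))
    + dot d z (dn (vadd p (vscal l z)) (vadd dp (vadd (vscal m z) (vscal l zeta)))) = 0.
Proof.
  intros Hp Hz Hz1 Hang Hl Hq Hdp Hdpn Hzeta Hzz Hfirst Hdq.
  destruct sin_cos_delta_pos as [Hs Hc]. pose proof (sin2_cos2 delta) as Hsc.
  unfold Rsqr in Hsc. pose proof (normal_unit p Hp) as Hnn.
  pose proof (normal_inRd p (proj1 Hp)) as Hnin.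
  assert (Hlin : forall x u : vec, vderiv (fun t => vadd x (vscal t u)) 0 u).
  { intros x u i. unfold vadd, vscal. apply is_derive_Reals. auto_derive; [exact I|ring]. }
  assert (Ep : vadd (vadd p (vscal 0 dp)) (vscal 0 (normal p)) = p)
    by (rewrite !vadd_scal0; reflexivity).
  destruct (implicit_root (fun t => vadd p (vscal t dp)) (fun _ => normal p) 0 0 dp (fun _ => 0))
    as (rho & rho' & eta1 & Heta1 & Hrho0 & Hrho & Hroot1).
  { intros t. apply inRd_add; [apply Hp|auto with inRd]. }
  { intros _. exact Hnin. }
  { apply Hlin. }
  { apply vderiv_const. }
  { rewrite Ep. apply Hp. }
  { rewrite Ep, (dot_gradF p _ Hp), Hnn. pose proof (gradF_pos p Hp). lra. }
  set (pp := fun t => vadd (vadd p (vscal t dp)) (vscal (rho t) (normal p))).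
  assert (Hppin : forall t, inRd d (pp t)).
  { intros t. unfold pp. apply inRd_add; [apply inRd_add; [apply Hp|auto with inRd]|auto with inRd]. }
  assert (Epp : pp 0 = p) by (unfold pp; rewrite Hrho0; exact Ep).
  assert (Hpp : vderiv pp 0 dp).
  { assert (Hpp : vderiv pp 0 (vadd dp (vscal rho' (normal p)))).
    { eapply vderiv_value.
      - apply vderiv_add; [apply Hlin|apply (vderiv_scal _ _ _ _ _ Hrho (vderiv_const _ _))].
      - intros i. unfold vadd, vscal. ring. }
    (* Since [dp] is already tangent at [p], tangency of [pp] forces the derivative [rho'] of the
       normal correction to vanish. *)
    pose proof (tangent_of_level pp 0 eta1 _ Hppin Heta1 Hroot1 Hpp) as Ht.
    rewrite Epp, dot_add_l, dot_scal_l, Hdpn, Hnn in Ht.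
    refine (vderiv_value _ _ _ _ Hpp _). intros i. unfold vadd, vscal.
    replace rho' with 0 by lra. ring. }
  set (nn := fun t => normal (pp t)).
  assert (Hnnd : vderiv nn 0 (dn p dp)).
  { pose proof (vderiv_normal pp 0 dp Hppin) as HH. rewrite Epp in HH. auto. }
  assert (Enn : nn 0 = normal p) by (unfold nn; rewrite Epp; reflexivity).
  set (y := fun t => vadd z (vscal t zeta)).
  assert (Hy : vderiv y 0 zeta) by apply Hlin.
  assert (Ey : y 0 = z) by apply vadd_scal0.
  (* The squared length of the part of [y] tangent at the foot. Adding a multiple of the normal does
     not change it, so the angle is [delta] exactly when the normal part is [tan delta] times its
     root [T]. *)
  set (T2 := fun t => dot d (y t) (y t) - dot d (y t) (nn t) * dot d (y t) (nn t)).
  assert (ET2 : T2 0 = cos delta * cos delta).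
  { unfold T2. rewrite Ey, Enn, Hz1, Hang. lra. }
  pose proof (derivable_pt_lim_dot d y nn 0 _ _ Hy Hnnd) as Hyn.
  rewrite Ey, Enn, Hfirst in Hyn.
  assert (HT2 : derivable_pt_lim T2 0 0).
  { pose proof (derivable_pt_lim_dot d y y 0 _ _ Hy Hy) as Hyy.
    refine (derivable_pt_lim_value _ _ _ _ (derivable_pt_lim_minus _ _ _ _ _ Hyy
      (derivable_pt_lim_mult _ _ _ _ _ Hyn Hyn)) _).
    rewrite Ey, (dot_comm d z zeta), Hzz. ring. }
  set (T := fun t => sqrt (T2 t)).
  assert (ET : T 0 = cos delta) by (unfold T; rewrite ET2; apply sqrt_square; lra).
  assert (HT : derivable_pt_lim T 0 0).
  { assert (0 < T2 0) by (rewrite ET2; nra).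
    refine (derivable_pt_lim_value _ _ _ _
      (derivable_pt_lim_comp _ _ _ _ _ HT2 (derivable_pt_lim_sqrt _ H)) _). ring. }
  set (r := fun t => tan delta * T t - dot d (y t) (nn t)).
  assert (Hr : derivable_pt_lim r 0 0).
  { refine (derivable_pt_lim_value _ _ _ _ (derivable_pt_lim_minus _ _ _ _ _
      (derivable_pt_lim_mult _ _ _ _ _ (derivable_pt_lim_const (tan delta) 0) HT) Hyn) _).
    unfold fct_cte. ring. }
  assert (Htan : tan delta * cos delta = sin delta) by (unfold tan; field; lra).
  assert (Er : r 0 = 0) by (unfold r; rewrite ET, Ey, Enn, Hang; lra).
  set (zz := fun t => vadd (y t) (vscal (r t) (nn t))).
  assert (Hzzin : forall t, inRd d (zz t)).
  { intros t. unfold zz, y, nn. apply inRd_add; [intros; cbv beta; auto with inRd|].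
    apply inRd_scal, normal_inRd, Hppin. }
  assert (Ezz : zz 0 = z) by (unfold zz; rewrite Er, Ey; apply vadd_scal0).
  assert (Hzzd : vderiv zz 0 zeta).
  { refine (vderiv_value _ _ _ _
      (vderiv_add _ _ _ _ _ Hy (vderiv_scal _ _ _ _ _ Hr Hnnd)) _).
    intros i. unfold vadd, vscal. rewrite Er. ring. }
  assert (Hznorm : vnorm d z = 1) by (unfold vnorm; rewrite Hz1; apply sqrt_1).
  assert (HzN : dot d z (normal (vadd p (vscal l z))) = - sin delta).
  { rewrite (chord_end_angle p z l); try assumption; rewrite Hznorm; lra. }
  destruct (implicit_root pp zz 0 l dp zeta Hppin Hzzin Hpp Hzzd)
    as (lam & lam' & eta2 & Heta2 & Hlam0 & Hlam & Hroot2).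
  { rewrite Epp, Ezz. apply Hq. }
  { rewrite Epp, Ezz, (dot_gradF _ z Hq), HzN. pose proof (gradF_pos _ Hq). nra. }
  set (qq := fun t => vadd (pp t) (vscal (lam t) (zz t))).
  assert (Hqqin : forall t, inRd d (qq t)) by (intros; unfold qq; auto with inRd).
  assert (Eqq : qq 0 = vadd p (vscal l z)) by (unfold qq; rewrite Epp, Ezz, Hlam0; reflexivity).
  assert (Hqq : vderiv qq 0 (vadd dp (vadd (vscal m z) (vscal l zeta)))).
  { pose proof (vderiv_add _ _ _ _ _ Hpp (vderiv_scal _ _ _ _ _ Hlam Hzzd)) as Hqq.
    rewrite Ezz, Hlam0 in Hqq.
    (* The velocity of [qq] and the prescribed velocity are both tangent at the end and differ by a
       multiple of [z]; as [z] is transverse there, [lam'] must be [m]. *)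
    pose proof (tangent_of_level qq 0 eta2 _ Hqqin Heta2 Hroot2 Hqq) as Ht.
    rewrite Eqq in Ht. rewrite !dot_add_l, !dot_scal_l, HzN in Ht, Hdq.
    replace m with lam'; [exact Hqq|]. nra. }
  pose proof (vderiv_normal qq 0 _ Hqqin ltac:(rewrite Eqq; exact Hq) Hqq) as HNN.
  rewrite Eqq in HNN.
  pose proof (derivable_pt_lim_dot d zz _ 0 _ _ Hzzd HNN) as Hfin.
  cbv beta in Hfin. rewrite Eqq, Ezz in Hfin.
  (* The varied direction has length [T / cos delta], so the Gutkin property gives its product with
     the normal at the end as [- tan delta * T], which is stationary at 0. *)
  assert (Hcst : derivable_pt_lim (fun t => - tan delta * T t) 0 0).
  { refine (derivable_pt_lim_value _ _ _ _
      (derivable_pt_lim_mult _ _ _ _ _ (derivable_pt_lim_const (- tan delta) 0) HT) _).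
    unfold fct_cte. ring. }
  apply (uniqueness_limite _ _ _ _ Hfin).
  (* These two neighbourhoods keep [T2] and the chord length [lam] positive. *)
  destruct (continuity_pt_near T2 0 (cos delta * cos delta)
    (derivable_pt_lim_cont _ _ _ HT2) ltac:(nra)) as [e3 [He3 H3]].
  destruct (continuity_pt_near lam 0 l (derivable_pt_lim_cont _ _ _ Hlam) Hl) as [e4 [He4 H4]].
  apply (derivable_pt_lim_local (fun t => - tan delta * T t) _ 0 0
    (Rmin (Rmin eta1 eta2) (Rmin e3 e4))); [repeat apply Rmin_pos; assumption| |exact Hcst].
  intros t Ht.
  assert (Ht1 : Rabs (t - 0) < eta1).
  { eapply Rlt_le_trans; [exact Ht|]. eapply Rle_trans; apply Rmin_l. }
  assert (Ht2 : Rabs (t - 0) < eta2).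
  { eapply Rlt_le_trans; [exact Ht|]. eapply Rle_trans; [apply Rmin_l|apply Rmin_r]. }
  assert (Ht3 : Rabs (t - 0) < e3).
  { eapply Rlt_le_trans; [exact Ht|]. eapply Rle_trans; [apply Rmin_r|apply Rmin_l]. }
  assert (Ht4 : Rabs (t - 0) < e4).
  { eapply Rlt_le_trans; [exact Ht|]. eapply Rle_trans; [apply Rmin_r|apply Rmin_r]. }
  specialize (H3 t Ht3). specialize (H4 t Ht4). rewrite ET2 in H3. rewrite Hlam0 in H4.
  apply Rabs_def2 in H3. apply Rabs_def2 in H4.
  assert (HonP : onS d F (pp t)) by (split; [apply Hppin|apply Hroot1, Ht1]).
  assert (HonQ : onS d F (qq t)) by (split; [apply Hqqin|apply Hroot2, Ht2]).
  assert (HTT : T t * T t = T2 t) by (apply sqrt_sqrt; lra).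
  assert (HTpos : 0 < T t) by (apply sqrt_lt_R0; lra).
  assert (Hnnt : dot d (nn t) (nn t) = 1) by (apply normal_unit, HonP).
  assert (Hzn : dot d (zz t) (nn t) = tan delta * T t).
  { unfold zz. rewrite dot_add_l, dot_scal_l, Hnnt. unfold r. ring. }
  assert (Hzznorm : vnorm d (zz t) = T t / cos delta).
  { apply Rsqr_inj; [apply vnorm_nonneg| |].
    - apply Rmult_le_pos; [lra|]. left. apply Rinv_0_lt_compat, Hc.
    - unfold Rsqr. rewrite vnorm_sq. unfold zz.
      rewrite dot_add_l, !dot_add_r, !dot_scal_l, !dot_scal_r, Hnnt, (dot_comm d (nn t) (y t)).
      replace (dot d (y t) (y t)) with (T2 t + dot d (y t) (nn t) * dot d (y t) (nn t))
        by (unfold T2; ring).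
      rewrite <- HTT. unfold r.
      replace (T t / cos delta * (T t / cos delta)) with
        (T t * T t * ((sin delta * sin delta + cos delta * cos delta) / (cos delta * cos delta)))
        by (rewrite Hsc; field; lra).
      unfold tan. field. lra. }
  symmetry. unfold qq. rewrite (chord_end_angle (pp t) (zz t) (lam t)).
  - rewrite Hzznorm. unfold tan. field. lra.
  - exact HonP.
  - apply Hzzin.
  - rewrite Hzznorm. apply Rdiv_lt_0_compat; assumption.
  - fold (nn t). rewrite Hzn, Hzznorm. unfold tan. field. lra.
  - lra.
  - exact HonQ.
Qed.

Lemma dot_dnormal_zero (x y : vec) : dot d y (dn x (fun _ => 0)) = 0.
Proof.
  assert (E : hess_app d hessF x (fun _ => 0) = fun _ => 0).
  { apply functional_extensionality. intros j. unfold hess_app.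
    destruct (Nat.ltb j d); [|reflexivity].
    apply sumd_eq0. intros; ring. }
  unfold dnormal. rewrite dot_add_r, !dot_scal_r, E, !dot_zero_r. unfold Rdiv. ring.
Qed.

(** * The chord map along a geodesic *)

Context (gamma v w : R -> vec) (k tau l : R -> R)
  (Hon : forall s, onS d F (gamma s))
  (Hgsm : forall i, smooth1 (fun s => gamma s i))
  (Hv : forall s, vderiv gamma s (v s))
  (Hvunit : forall s, vnorm d (v s) = 1)
  (Hgeod : forall s i, derivable_pt_lim (fun t => v t i) s (k s * normal (gamma s) i))
  (Hn : forall s i, derivable_pt_lim (fun t => normal (gamma t) i) s
                      (- k s * v s i + tau s * w s i))
  (Hw : forall s, inRd d (w s) /\ vnorm d (w s) = 1 /\ dot d (w s) (v s) = 0 /\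
                  dot d (w s) (normal (gamma s)) = 0).

Local Notation sd := (sin delta).
Local Notation cd := (cos delta).

Definition chord_dir (s : R) : vec :=
  vadd (vscal cd (v s)) (vscal sd (normal (gamma s))).

Definition chord_conormal (s : R) : vec :=
  vadd (vscal (- sd) (v s)) (vscal cd (normal (gamma s))).

Local Notation z := chord_dir.
Local Notation e := chord_conormal.

Definition chord_end (s : R) : vec := vadd (gamma s) (vscal (l s) (z s)).

Local Notation Gam := chord_end.
Local Notation N := (fun s => normal (chord_end s)).

Context (Hl : forall s, 0 < l s /\ onS d F (Gam s)).

Lemma gamma_inRd (s : R) : inRd d (gamma s).
Proof. apply Hon. Qed.

Lemma v_inRd (s : R) : inRd d (v s).
Proof. exact (vderiv_inRd d gamma s _ gamma_inRd (Hv s)). Qed.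

Lemma w_inRd (s : R) : inRd d (w s).
Proof. apply Hw. Qed.

Lemma n_inRd (s : R) : inRd d (normal (gamma s)).
Proof. apply normal_inRd, gamma_inRd. Qed.

Lemma z_inRd (s : R) : inRd d (z s).
Proof. pose proof (v_inRd s). pose proof (n_inRd s). unfold chord_dir. auto with inRd. Qed.

Lemma e_inRd (s : R) : inRd d (e s).
Proof. pose proof (v_inRd s). pose proof (n_inRd s). unfold chord_conormal. auto with inRd. Qed.

Lemma Gam_inRd (s : R) : inRd d (Gam s).
Proof. apply Hl. Qed.

Lemma frame_vn (s : R) :
  dot d (v s) (v s) = 1 /\ dot d (w s) (w s) = 1 /\
  dot d (normal (gamma s)) (normal (gamma s)) = 1 /\ dot d (v s) (normal (gamma s)) = 0 /\
  dot d (w s) (v s) = 0 /\ dot d (w s) (normal (gamma s)) = 0.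
Proof.
  destruct (Hw s) as (_ & Hw1 & Hwv & Hwn). repeat split; try assumption.
  - rewrite <- vnorm_sq, Hvunit. ring.
  - rewrite <- vnorm_sq, Hw1. ring.
  - apply normal_unit, Hon.
  - apply (tangent_of_level gamma s 1); [apply gamma_inRd|lra|intros; apply Hon|apply Hv].
Qed.

Lemma frame_ze (s : R) :
  dot d (z s) (z s) = 1 /\ dot d (e s) (e s) = 1 /\ dot d (z s) (e s) = 0 /\
  dot d (w s) (z s) = 0 /\ dot d (w s) (e s) = 0 /\
  dot d (z s) (normal (gamma s)) = sd /\ dot d (e s) (normal (gamma s)) = cd.
Proof.
  destruct (frame_vn s) as (Hvv & Hww & Hnn & Hvn & Hwv & Hwn).
  pose proof (sin2_cos2 delta) as Hsc. unfold Rsqr in Hsc.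
  unfold chord_dir, chord_conormal.
  rewrite !dot_add_l, !dot_add_r, !dot_scal_l, !dot_scal_r, (dot_comm d (normal (gamma s)) (v s)),
    Hvv, Hnn, Hvn, Hwv, Hwn.
  repeat split; nra.
Qed.

Lemma vderiv_z (s : R) : vderiv z s (vadd (vscal (k s) (e s)) (vscal (tau s * sd) (w s))).
Proof.
  intros i. unfold chord_dir, chord_conormal, vadd, vscal.
  refine (derivable_pt_lim_value _ _ _ _ (derivable_pt_lim_plus _ _ _ _ _
    (derivable_pt_lim_scal _ cd _ _ (Hgeod s i)) (derivable_pt_lim_scal _ sd _ _ (Hn s i))) _).
  ring.
Qed.

Lemma vderiv_e (s : R) :
  vderiv e s (vadd (vscal (- k s) (z s)) (vscal (tau s * cd) (w s))).
Proof.
  intros i. unfold chord_dir, chord_conormal, vadd, vscal.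
  refine (derivable_pt_lim_value _ _ _ _ (derivable_pt_lim_plus _ _ _ _ _
    (derivable_pt_lim_scal _ (- sd) _ _ (Hgeod s i)) (derivable_pt_lim_scal _ cd _ _ (Hn s i))) _).
  ring.
Qed.

(** Uniqueness of derivatives matches the differential of the normal with the given expansion of
    [n']; [k] and [tau] enter the shape operator at the foot through this. *)
Lemma dot_dnormal_v (s : R) (x : vec) :
  dot d x (dn (gamma s) (v s)) = - k s * dot d x (v s) + tau s * dot d x (w s).
Proof.
  rewrite <- !dot_scal_r, <- dot_add_r. apply sumd_ext. intros i _. f_equal.
  exact (uniqueness_limite _ _ _ _
    (vderiv_normal gamma s (v s) gamma_inRd (Hon s) (Hv s) i) (Hn s i)).
Qed.

Lemma vnorm_z (s : R) : vnorm d (z s) = 1.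
Proof. unfold vnorm. rewrite (proj1 (frame_ze s)). apply sqrt_1. Qed.

Lemma dot_z_N (s : R) : dot d (z s) (N s) = - sd.
Proof.
  destruct (frame_ze s) as (_ & _ & _ & _ & _ & Hzn & _). destruct (Hl s) as [Hl0 HG0].
  cbv beta. unfold chord_end. rewrite (chord_end_angle (gamma s) (z s) (l s)); auto.
  - rewrite vnorm_z. ring.
  - apply z_inRd.
  - rewrite vnorm_z. lra.
  - rewrite vnorm_z, Hzn. ring.
Qed.

(** The value of [l'] forced by tangency of the velocity of [chord_end], given that the product of
    [z] and [N] is [- sin delta]. The explicit formula makes continuity of [l'] visible. *)
Definition chord_speed (s : R) : R :=
  (dot d (v s) (N s) + l s * (k s * dot d (e s) (N s) + tau s * sd * dot d (w s) (N s))) / sd.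

Local Notation dl := chord_speed.

Lemma vderiv_chord_end (s : R) (l' : R) : derivable_pt_lim l s l' ->
  vderiv Gam s (vadd (v s) (vadd (vscal l' (z s))
    (vscal (l s) (vadd (vscal (k s) (e s)) (vscal (tau s * sd) (w s)))))).
Proof.
  intros H. unfold chord_end.
  apply vderiv_add; [apply Hv|apply (vderiv_scal _ _ _ _ _ H (vderiv_z s))].
Qed.

(** The branch [rho] found by [implicit_root] stays positive near [s], so [chord_length_unique]
    makes it agree with [l] there, and [l] inherits its derivative. *)
Lemma derivable_chord_length (s : R) : derivable_pt_lim l s (dl s).
Proof.
  destruct sin_cos_delta_pos as [Hs Hc]. destruct (Hl s) as [Hl0 Hq].
  destruct (implicit_root gamma z s (l s) _ _ gamma_inRd z_inRd (Hv s) (vderiv_z s))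
    as (rho & rho' & eta & Heta & Hrho0 & Hrho & Hroot).
  { apply Hq. }
  { change (dot d (z s) (gradF (Gam s)) <> 0).
    rewrite (dot_gradF _ _ Hq), dot_z_N. pose proof (gradF_pos _ Hq). nra. }
  destruct (continuity_pt_near rho s (l s) (derivable_pt_lim_cont _ _ _ Hrho) Hl0)
    as [eta' [Heta' Hpos]].
  assert (Hlr : derivable_pt_lim l s rho').
  { apply (derivable_pt_lim_local rho l s rho' (Rmin eta eta'));
      [apply Rmin_pos; assumption| |exact Hrho].
    intros t Ht.
    specialize (Hroot t (Rlt_le_trans _ _ _ Ht (Rmin_l _ _))).
    specialize (Hpos t (Rlt_le_trans _ _ _ Ht (Rmin_r _ _))).
    rewrite Hrho0 in Hpos. apply Rabs_def2 in Hpos. destruct (Hl t) as [Hlt Hqt].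
    apply (chord_length_unique (gamma t) (z t)); auto.
    - apply z_inRd.
    - rewrite vnorm_z. lra.
    - rewrite vnorm_z, Rmult_1_r. apply frame_ze.
    - lra.
    - split; [|exact Hroot]. apply inRd_add; [apply gamma_inRd|apply inRd_scal, z_inRd]. }
  pose proof (tangent_of_level Gam s 1 _ Gam_inRd Rlt_0_1
    (fun t _ => proj2 (proj2 (Hl t))) (vderiv_chord_end s rho' Hlr)) as Ht.
  pose proof (dot_z_N s) as HzN. cbv beta in HzN.
  rewrite !dot_add_l, !dot_scal_l, !dot_add_l, !dot_scal_l, HzN in Ht.
  refine (derivable_pt_lim_value _ _ _ _ Hlr _). unfold chord_speed.
  apply (Rmult_eq_reg_r sd); [|lra].
  unfold Rdiv. rewrite Rmult_assoc, Rinv_l by lra. lra.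
Qed.

Definition dchord_end (s : R) : vec :=
  vadd (v s) (vadd (vscal (dl s) (z s))
    (vscal (l s) (vadd (vscal (k s) (e s)) (vscal (tau s * sd) (w s))))).

Lemma vderiv_N (s : R) : vderiv N s (dn (Gam s) (dchord_end s)).
Proof.
  apply vderiv_normal; [apply Gam_inRd|apply Hl|].
  apply vderiv_chord_end, derivable_chord_length.
Qed.

Local Notation a := (fun s => k s * l s - sd).
Local Notation b := (fun s => l s * tau s * sd).

Lemma dot_dchord_end (s : R) (x : vec) :
  dot d (dchord_end s) x =
  (cd + dl s) * dot d (z s) x + (a s * dot d (e s) x + b s * dot d (w s) x).
Proof.
  pose proof (sin2_cos2 delta) as Hsc. unfold Rsqr in Hsc.
  unfold dchord_end. rewrite !dot_add_l, !dot_scal_l, !dot_add_l, !dot_scal_l.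
  assert (E : dot d (v s) x = cd * dot d (z s) x - sd * dot d (e s) x).
  { unfold chord_dir, chord_conormal. rewrite !dot_add_l, !dot_scal_l.
    replace (dot d (v s) x) with ((sd * sd + cd * cd) * dot d (v s) x) at 1
      by (rewrite Hsc; ring). ring. }
  rewrite E. ring.
Qed.

Lemma dchord_end_tangent (s : R) : dot d (dchord_end s) (N s) = 0.
Proof.
  apply (tangent_of_level Gam s 1 _ Gam_inRd Rlt_0_1 (fun t _ => proj2 (proj2 (Hl t)))).
  apply vderiv_chord_end, derivable_chord_length.
Qed.

(* Variation of the foot [gamma s] of the chord with its end held fixed. *)
Lemma foot_variation (s : R) (dp : vec) : inRd d dp ->
  dot d dp (normal (gamma s)) = 0 ->
  (sd - k s * l s) * dot d dp (v s) + l s * tau s * dot d dp (w s) = 0 ->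
  dot d dp (N s) + sd * dot d dp (z s) = 0.
Proof.
  intros Hdp Hdpn HY. destruct (Hl s) as [Hl0 Hq].
  destruct (frame_vn s) as (Hvv & Hww & Hnn & Hvn & Hwv & Hwn).
  destruct (frame_ze s) as (Hzz & Hee & Hze & Hwz & Hwe & Hzn & Hen).
  (* [m] and [zeta] are the only choice that is orthogonal to [z] and gives the end zero
     velocity. *)
  set (m := - dot d dp (z s)).
  set (zeta := vscal (- / l s) (vadd dp (vscal m (z s)))).
  assert (E0 : vadd dp (vadd (vscal m (z s)) (vscal (l s) zeta)) = fun _ => 0).
  { apply functional_extensionality. intros i. unfold zeta, vadd, vscal. field. lra. }
  assert (Hdz : dot d dp (z s) = cd * dot d dp (v s)).
  { unfold chord_dir. rewrite dot_add_r, !dot_scal_r, Hdpn. ring. }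
  assert (Hzv : forall x, dot d (z s) (dn (gamma s) x) = cd * dot d (v s) (dn (gamma s) x)).
  { intros x. unfold chord_dir. rewrite dot_add_l, !dot_scal_l, normal_dnormal by apply Hon.
    ring. }
  pose proof (chord_variation (gamma s) (z s) dp zeta (l s) m (Hon s) (z_inRd s) Hzz Hzn
    Hl0 Hq Hdp Hdpn) as H.
  fold (Gam s) in H. rewrite E0, dot_dnormal_zero in H.
  assert (HH : dot d zeta (N s) + 0 = 0).
  { apply H.
    - unfold zeta. apply inRd_scal, inRd_add; [exact Hdp|apply inRd_scal, z_inRd].
    - unfold zeta. rewrite dot_scal_l, dot_add_l, dot_scal_l, Hzz. unfold m. ring.
    (* Symmetry of the shape operator moves the differential of the normal onto [v], where it is
       known; the first-order condition at the foot then becomes a multiple of [HY]. *)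
    - rewrite Hzv, (dnormal_sym (gamma s) dp (v s) (Hon s) Hdpn Hvn), dot_dnormal_v.
      unfold zeta. rewrite dot_scal_l, dot_add_l, dot_scal_l, Hzn, Hdpn. unfold m.
      rewrite Hdz. apply (Rmult_eq_reg_l (l s)); [|lra].
      replace (l s * (- / l s * (0 + - (cd * dot d dp (v s)) * sd) +
        cd * (- k s * dot d dp (v s) + tau s * dot d dp (w s)))) with
        (cd * ((sd - k s * l s) * dot d dp (v s) + l s * tau s * dot d dp (w s)))
        by (field; lra).
      rewrite HY. ring.
    - rewrite dot_comm. apply dot_zero_r. }
  unfold zeta in HH. cbv beta in HH.
  pose proof (dot_z_N s) as HzN. cbv beta in HzN.
  rewrite dot_scal_l, dot_add_l, dot_scal_l, HzN in HH. unfold m in HH. cbv beta.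
  assert (Hil : 0 < / l s) by (apply Rinv_0_lt_compat, Hl0). nra.
Qed.

(* The end of the chord moves in the plane of the chord and its normal there. *)
Lemma chord_end_direction (s : R) :
  cd + dl s <> 0 /\
  forall x, cd * cd * (a s * dot d (e s) x + b s * dot d (w s) x)
            = sd * (cd + dl s) * (dot d (N s) x + sd * dot d (z s) x).
Proof.
  destruct sin_cos_delta_pos as [Hs Hc]. pose proof (sin2_cos2 delta) as Hsc.
  unfold Rsqr in Hsc. destruct (Hl s) as [Hl0 Hq].
  destruct (frame_vn s) as (Hvv & Hww & Hnn & Hvn & Hwv & Hwn).
  destruct (frame_ze s) as (Hzz & Hee & Hze & Hwz & Hwe & Hzn & Hen).
  pose proof (dot_z_N s) as HzN. pose proof (normal_unit _ Hq) as HNN.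
  pose proof (foot_variation s) as HF0. pose proof (dchord_end_tangent s) as Htan.
  rewrite dot_dchord_end in Htan.
  pose proof (v_inRd s) as Hvin. pose proof (n_inRd s) as Hnin. pose proof (z_inRd s) as Hzin.
  pose proof (w_inRd s) as Hwin.
  pose proof (normal_inRd _ (Gam_inRd s)) as HNin. cbv beta in *.
  set (n := normal (gamma s)) in *. set (Nq := normal (Gam s)) in *.
  (* The component of [N] orthogonal to [z], of length [cd]. *)
  set (U := vadd Nq (vscal sd (z s))).
  assert (HUz : dot d U (z s) = 0).
  { unfold U. rewrite dot_add_l, dot_scal_l, (dot_comm d Nq), HzN, Hzz. ring. }
  assert (HUN : dot d U Nq = cd * cd).
  { unfold U. rewrite dot_add_l, dot_scal_l, HzN, HNN. lra. }
  assert (HUU : dot d U U = cd * cd).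
  { unfold U at 2. rewrite dot_add_r, dot_scal_r, HUN, HUz. ring. }
  set (kap := dot d U n).
  assert (HUv : cd * dot d U (v s) = - sd * kap).
  { unfold chord_dir in HUz. rewrite dot_add_r, !dot_scal_r in HUz. fold n kap in HUz. lra. }
  set (ET := vadd U (vscal (- kap) n)).
  assert (HETn : dot d ET n = 0).
  { unfold ET. rewrite dot_add_l, dot_scal_l, Hnn. fold kap. ring. }
  assert (HETU : dot d ET U = cd * cd - kap * kap).
  { unfold ET. rewrite dot_add_l, dot_scal_l, HUU, (dot_comm d n U). fold kap. ring. }
  (* [U] is not normal at the foot: Bessel's inequality for [ET] against [v], with [HUv], bounds the
     square of [kap] by the fourth power of [cd], which is below its square. *)
  assert (HETpos : 0 < cd * cd - kap * kap).
  { pose proof (dot_self_nonneg d (vadd ET (vscal (- dot d U (v s)) (v s)))) as Hb.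
    assert (HETv : dot d ET (v s) = dot d U (v s)).
    { unfold ET. rewrite dot_add_l, dot_scal_l, (dot_comm d n), Hvn. ring. }
    assert (HETET : dot d ET ET = cd * cd - kap * kap).
    { unfold ET at 2. rewrite dot_add_r, dot_scal_r, HETU, HETn. ring. }
    rewrite dot_add_l, !dot_add_r, !dot_scal_l, !dot_scal_r, (dot_comm d (v s) ET),
      HETv, HETET, Hvv in Hb.
    set (x := dot d U (v s)) in *.
    assert (x * x <= cd * cd - kap * kap) by nra.
    assert (cd * cd * (x * x) = sd * sd * (kap * kap)).
    { replace (cd * cd * (x * x)) with ((cd * x) * (cd * x)) by ring. rewrite HUv. ring. }
    assert (kap * kap <= cd * cd * (cd * cd)) by nra.
    assert (0 < sd * sd) by nra. assert (0 < cd * cd) by nra.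
    replace (cd * cd * (cd * cd)) with (cd * cd - cd * cd * (sd * sd)) in *
      by (replace (sd * sd) with (1 - cd * cd) by lra; ring).
    assert (0 < cd * cd * (sd * sd)) by (apply Rmult_lt_0_compat; assumption). lra. }
  set (Y := vadd (vscal (sd - k s * l s) (v s)) (vscal (l s * tau s) (w s))).
  assert (HYdot : forall x, dot d x Y
    = (sd - k s * l s) * dot d x (v s) + l s * tau s * dot d x (w s)).
  { intros x. unfold Y. rewrite dot_add_r, !dot_scal_r. reflexivity. }
  assert (HYn : dot d Y n = 0).
  { unfold Y. rewrite dot_add_l, !dot_scal_l, Hvn, Hwn. ring. }
  assert (HFU : forall dp, inRd d dp -> dot d dp n = 0 -> dot d dp Y = 0 -> dot d dp U = 0).
  { intros dp H1 H2 H3. unfold U. rewrite dot_add_r, dot_scal_r. apply HF0; auto.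
    rewrite <- HYdot. exact H3. }
  assert (HETin : inRd d ET) by (unfold ET, U; auto with inRd).
  assert (HYin : inRd d Y) by (unfold Y; auto with inRd).
  assert (HYY : dot d Y Y <> 0).
  { intros H0. pose proof (HFU ET HETin HETn) as H. rewrite (dot_comm d ET Y) in H.
    rewrite (dot_self_zero d Y H0), HETU in H. specialize (H eq_refl). lra. }
  (* The unnormalized Gram-Schmidt remainder of [ET] after [Y]. Being orthogonal to [Y] it is
     orthogonal to [U], hence to itself, so [ET] is a multiple of [Y]. *)
  set (dp := vadd (vscal (dot d Y Y) ET) (vscal (- dot d ET Y) Y)).
  assert (Hdpx : forall x, dot d dp x = dot d Y Y * dot d ET x - dot d ET Y * dot d Y x).
  { intros x. unfold dp. rewrite dot_add_l, !dot_scal_l. ring. }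
  assert (Hdpn : dot d dp n = 0) by (rewrite Hdpx, HETn, HYn; ring).
  assert (HdpY : dot d dp Y = 0) by (rewrite Hdpx; ring).
  assert (HdpU : dot d dp U = 0) by (apply HFU; [unfold dp; auto with inRd|assumption..]).
  assert (Hdp0 : forall x, dot d dp x = 0).
  { apply dot_self_zero. unfold dp at 2. rewrite dot_add_r, !dot_scal_r, HdpY.
    unfold ET. rewrite dot_add_r, dot_scal_r, HdpU, Hdpn. ring. }
  set (mu := dot d ET Y / dot d Y Y).
  assert (HU : forall x, dot d U x = kap * dot d n x + mu * dot d Y x).
  { intros x. specialize (Hdp0 x). rewrite Hdpx in Hdp0.
    assert (E : dot d ET x = mu * dot d Y x).
    { unfold mu. apply (Rmult_eq_reg_l (dot d Y Y)); [|exact HYY].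
      replace (dot d Y Y * (dot d ET Y / dot d Y Y * dot d Y x))
        with (dot d ET Y * dot d Y x) by (field; exact HYY). lra. }
    rewrite <- E. unfold ET. rewrite dot_add_l, dot_scal_l. ring. }
  assert (Hkap : sd * kap = mu * (k s * l s - sd) * cd).
  { specialize (HU (z s)). rewrite HUz, (dot_comm d n), Hzn in HU.
    assert (dot d Y (z s) = (sd - k s * l s) * cd).
    { rewrite dot_comm, HYdot, (dot_comm d _ (w s)), Hwz.
      unfold chord_dir. rewrite dot_add_l, !dot_scal_l, Hvv, (dot_comm d _ (v s)).
      fold n. rewrite Hvn. ring. }
    rewrite H in HU. lra. }
  assert (HsU : forall x, sd * dot d U x
    = mu * ((k s * l s - sd) * dot d (e s) x + l s * tau s * sd * dot d (w s) x)).
  { intros x. rewrite HU.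
    replace (sd * (kap * dot d n x + mu * dot d Y x))
      with ((sd * kap) * dot d n x + sd * mu * dot d Y x) by ring.
    rewrite Hkap. unfold chord_conormal, Y. fold n. rewrite !dot_add_l, !dot_scal_l. ring. }
  (* Pairing with [N] and using tangency of the velocity of the end determines [mu] and excludes
     [cd + dl s = 0]. *)
  assert (Hmu : mu * (cd + dl s) = cd * cd).
  { pose proof (HsU Nq) as H. rewrite HUN in H. rewrite HzN in Htan.
    apply (Rmult_eq_reg_l sd); [|lra].
    replace ((k s * l s - sd) * dot d (e s) Nq + l s * tau s * sd * dot d (w s) Nq)
      with (sd * (cd + dl s)) in H by lra. lra. }
  split.
  - intros H0. rewrite H0 in Hmu. nra.
  - intros x. pose proof (HsU x) as H.
    assert (EU : dot d U x = dot d Nq x + sd * dot d (z s) x)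
      by (unfold U; rewrite dot_add_l, dot_scal_l; reflexivity).
    rewrite <- EU, <- Hmu.
    replace (sd * (cd + dl s) * dot d U x) with ((cd + dl s) * (sd * dot d U x)) by ring.
    rewrite H. ring.
Qed.

(** The squared lengths of the two sides of [chord_end_direction], with one common factor [cd * cd]
    cancelled. *)
Lemma chord_speed_sq (s : R) :
  cd * cd * (a s * a s + b s * b s) = sd * sd * ((cd + dl s) * (cd + dl s)).
Proof.
  destruct sin_cos_delta_pos as [Hs Hc]. pose proof (sin2_cos2 delta) as Hsc.
  unfold Rsqr in Hsc. destruct (frame_vn s) as (_ & Hww & _).
  destruct (frame_ze s) as (Hzz & Hee & Hze & Hwz & Hwe & Hzn & Hen).
  destruct (chord_end_direction s) as [HK H].
  pose proof (H (e s)) as He. pose proof (H (w s)) as Hwx. pose proof (H (N s)) as HNx.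
  pose proof (dot_z_N s) as HzN. pose proof (normal_unit _ (proj2 (Hl s))) as HNN.
  cbv beta in *.
  rewrite Hwe, Hze, Hee in He. rewrite (dot_comm d _ (w s)), Hwe, Hww, (dot_comm d (z s)), Hwz in Hwx.
  rewrite HNN, HzN in HNx. rewrite (dot_comm d _ (e s)) in He. rewrite (dot_comm d _ (w s)) in Hwx.
  set (x := dot d (e s) (normal (Gam s))) in *. set (y := dot d (w s) (normal (Gam s))) in *.
  set (K := cd + dl s) in *. set (A := k s * l s - sd) in *. set (B := l s * tau s * sd) in *.
  assert (E1 : cd * cd * (A * x + B * y) = sd * K * (cd * cd)) by (rewrite HNx; f_equal; lra).
  assert (E2 : cd * cd * A = sd * K * x) by lra.
  assert (E3 : cd * cd * B = sd * K * y) by lra.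
  assert (E4 : A * x + B * y = sd * K).
  { apply (Rmult_eq_reg_l (cd * cd)); [rewrite E1; ring|nra]. }
  replace (cd * cd * (A * A + B * B)) with (A * (cd * cd * A) + B * (cd * cd * B)) by ring.
  rewrite E2, E3.
  replace (A * (sd * K * x) + B * (sd * K * y)) with (sd * K * (A * x + B * y)) by ring.
  rewrite E4. ring.
Qed.

(** The quarter turn of [a e + b w] in the plane of [e] and [w], hence orthogonal to [z] and to the
    velocity of the end. *)
Definition chord_transverse (s : R) : vec := vadd (vscal (- b s) (e s)) (vscal (a s) (w s)).

Local Notation Q := chord_transverse.

Lemma transverse_tangent (s : R) : dot d (N s) (Q s) = 0.
Proof.
  destruct sin_cos_delta_pos as [Hs Hc]. destruct (chord_end_direction s) as [HK H].
  destruct (frame_vn s) as (_ & Hww & _).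
  destruct (frame_ze s) as (Hzz & Hee & Hze & Hwz & Hwe & Hzn & Hen).
  specialize (H (Q s)). cbv beta in *.
  assert (E1 : dot d (e s) (Q s) = - (l s * tau s * sd)).
  { unfold chord_transverse. rewrite dot_add_r, !dot_scal_r, Hee, (dot_comm d _ (w s)), Hwe. ring. }
  assert (E2 : dot d (w s) (Q s) = k s * l s - sd).
  { unfold chord_transverse. rewrite dot_add_r, !dot_scal_r, Hwe, Hww. ring. }
  assert (E3 : dot d (z s) (Q s) = 0).
  { unfold chord_transverse. rewrite dot_add_r, !dot_scal_r, Hze, (dot_comm d _ (w s)), Hwz. ring. }
  rewrite E1, E2, E3 in H.
  assert (H0 : sd * (cd + dl s) * dot d (normal (Gam s)) (Q s) = 0) by lra.
  apply Rmult_integral in H0. destruct H0 as [H0|H0]; [|exact H0].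
  apply Rmult_integral in H0. destruct H0; [lra|contradiction].
Qed.

(* The symmetry of the shape operator at the end of the chord exchanges the motion of the
   end with the transverse direction, which is then reached by moving the foot along [w]. *)
Lemma transverse_turning (s : R) :
  dot d (Q s) (dn (Gam s) (dchord_end s)) = tau s * sd.
Proof.
  destruct sin_cos_delta_pos as [Hs Hc]. pose proof (sin2_cos2 delta) as Hsc.
  unfold Rsqr in Hsc. destruct (Hl s) as [Hl0 Hq].
  destruct (frame_vn s) as (Hvv & Hww & Hnn & Hvn & Hwv & Hwn).
  destruct (frame_ze s) as (Hzz & Hee & Hze & Hwz & Hwe & Hzn & Hen).
  destruct (chord_end_direction s) as [HK Hdir].
  pose proof (transverse_tangent s) as HNQ. pose proof (dchord_end_tangent s) as HGN.
  cbv beta in *.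
  (* [zeta] carries the end along [Q] when the foot moves by [sd w]. The factor [sd] keeps the angle
     at the foot stationary: [- b cd / l] cancels [cd tau sd]. *)
  set (zeta := vscal (/ l s) (vadd (Q s) (vscal (- sd) (w s)))).
  assert (HQin : inRd d (Q s)).
  { pose proof (e_inRd s). pose proof (w_inRd s). unfold chord_transverse. auto with inRd. }
  assert (E0 : vadd (vscal sd (w s)) (vadd (vscal 0 (z s)) (vscal (l s) zeta)) = Q s).
  { apply functional_extensionality. intros i. unfold zeta, vadd, vscal. field. lra. }
  pose proof (chord_variation (gamma s) (z s) (vscal sd (w s)) zeta (l s) 0 (Hon s)
    (z_inRd s) Hzz Hzn Hl0 Hq) as H.
  fold (Gam s) in H. rewrite E0 in H.
  assert (Hwt : dot d (vscal sd (w s)) (normal (gamma s)) = 0) by (rewrite dot_scal_l, Hwn; ring).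
  assert (HH : dot d zeta (normal (Gam s)) + dot d (z s) (dn (Gam s) (Q s)) = 0).
  { apply H.
    - apply inRd_scal, w_inRd.
    - exact Hwt.
    - unfold zeta. apply inRd_scal, inRd_add; [exact HQin|apply inRd_scal, w_inRd].
    - unfold zeta, chord_transverse. rewrite dot_scal_l, !dot_add_l, !dot_scal_l, Hwz,
        (dot_comm d (e s)), Hze. ring.
    - assert (Hzv : dot d (z s) (dn (gamma s) (vscal sd (w s))) = cd * (tau s * sd)).
      { unfold chord_dir at 1. rewrite dot_add_l, !dot_scal_l, normal_dnormal by apply Hon.
        rewrite (dnormal_sym (gamma s) _ (v s) (Hon s) Hwt Hvn), dot_dnormal_v, !dot_scal_l, Hwv, Hww.
        ring. }
      rewrite Hzv. unfold zeta, chord_transverse.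
      rewrite dot_scal_l, !dot_add_l, !dot_scal_l, Hwn, Hen. field. lra.
    - rewrite dot_comm. exact HNQ. }
  assert (Hzx : dot d (z s) (dn (Gam s) (Q s)) = sd / l s * dot d (w s) (normal (Gam s))).
  { unfold zeta in HH. rewrite dot_scal_l, dot_add_l, dot_scal_l, (dot_comm d (Q s)), HNQ in HH.
    unfold Rdiv. lra. }
  rewrite (dnormal_sym (Gam s) (dchord_end s) (Q s) Hq HGN) by (rewrite dot_comm; exact HNQ).
  rewrite dot_dchord_end.
  pose proof (Hdir (dn (Gam s) (Q s))) as Hx. rewrite normal_dnormal in Hx by exact Hq.
  pose proof (Hdir (w s)) as Hwx.
  rewrite (dot_comm d (e s)), Hwe, Hww, (dot_comm d (z s)), Hwz, (dot_comm d _ (w s)) in Hwx.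
  set (X := dn (Gam s) (Q s)) in *. set (y := dot d (w s) (normal (Gam s))) in *.
  set (R1 := (k s * l s - sd) * dot d (e s) X + l s * tau s * sd * dot d (w s) X) in *.
  apply (Rmult_eq_reg_l (cd * cd)); [|nra].
  rewrite Rmult_plus_distr_l, Hx, Hzx.
  replace (cd * cd * ((cd + dl s) * (sd / l s * y)) +
    sd * (cd + dl s) * (0 + sd * (sd / l s * y))) with
    ((sd * sd + cd * cd) * (sd * (cd + dl s) * y) / l s) by (field; lra).
  rewrite Hsc. replace (sd * (cd + dl s) * y) with (cd * cd * (l s * tau s * sd)) by lra.
  field. lra.
Qed.

(** Here [k] is the product of the second derivative of [gamma] with [n]. Since [n'] is orthogonal
    to [n], its derivative is the product of the third derivative with [n], which is continuous. *)
Lemma curvature_C1 : exists dk, continuity dk /\ forall s, derivable_pt_lim k s (dk s).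
Proof.
  set (fs := fun i => proj1_sig (constructive_indefinite_description _ (Hgsm i))).
  assert (Hfs : forall i, (forall x, fs i 0%nat x = gamma x i) /\
    forall n x, derivable_pt_lim (fs i n) x (fs i (S n) x)).
  { intros i. unfold fs. apply proj2_sig. }
  assert (E1 : forall i s, fs i 1%nat s = v s i).
  { intros i s. destruct (Hfs i) as [H0 H1].
    apply (uniqueness_limite (fs i 0%nat) s); [apply H1|].
    apply (derivable_pt_lim_eqf (fun t => gamma t i)); [intros; symmetry; apply H0|apply Hv]. }
  assert (E2 : forall i s, fs i 2%nat s = k s * normal (gamma s) i).
  { intros i s. destruct (Hfs i) as [H0 H1].
    apply (uniqueness_limite (fs i 1%nat) s); [apply H1|].
    apply (derivable_pt_lim_eqf (fun t => v t i)); [intros; symmetry; apply E1|apply Hgeod]. }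
  assert (Ek : forall x s, dot d (fun i => fs i 2%nat s) x = k s * dot d (normal (gamma s)) x).
  { intros x s. rewrite <- dot_scal_l. apply sumd_ext. intros i _. rewrite E2. reflexivity. }
  exists (fun s => dot d (fun i => fs i 3%nat s) (normal (gamma s))). split.
  - intros s. apply (continuity_pt_dot d (fun s i => fs i 3%nat s)); intros i _.
    + eapply derivable_pt_lim_cont, (proj2 (Hfs i)).
    + eapply derivable_pt_lim_cont, Hn.
  - intros s. apply (derivable_pt_lim_eqf
      (fun t => dot d (fun i => fs i 2%nat t) (normal (gamma t)))).
    { intros t. rewrite Ek, (proj1 (proj2 (proj2 (frame_vn t)))). ring. }
    destruct (frame_vn s) as (Hvv & Hww & Hnn & Hvn & Hwv & Hwn).
    refine (derivable_pt_lim_value _ _ _ _ (derivable_pt_lim_dot d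
      (fun t i => fs i 2%nat t) (fun t => normal (gamma t)) s (fun i => fs i 3%nat s)
      (vadd (vscal (- k s) (v s)) (vscal (tau s) (w s))) _ (Hn s)) _).
    + intros i. apply (proj2 (Hfs i)).
    + rewrite Ek, dot_add_r, !dot_scal_r, !(dot_comm d (normal (gamma s))), Hvn, Hwn. ring.
Qed.

(** There is no formula for [w'], only its products with [e], [z] and [w], from orthonormality of
    the frame. They suffice, because [chord_end_direction] places [N] in the span of these three
    vectors. *)
Lemma torsion_ode (s dk taud : R) (dw : vec) :
  derivable_pt_lim k s dk -> derivable_pt_lim tau s taud -> vderiv w s dw ->
  l s * sd * a s * taud
  + sd * ((a s + sd * (cd + dl s) / cd) * dl s - l s * (dk * l s + k s * dl s)) * tau s = 0.
Proof.
  intros Hk Htau Hdw.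
  destruct sin_cos_delta_pos as [Hs Hc]. pose proof (sin2_cos2 delta) as Hsc.
  unfold Rsqr in Hsc. destruct (Hl s) as [Hl0 Hq].
  destruct (frame_vn s) as (Hvv & Hww & Hnn & Hvn & Hwv & Hwn).
  destruct (frame_ze s) as (Hzz & Hee & Hze & Hwz & Hwe & Hzn & Hen).
  destruct (chord_end_direction s) as [HK Hdir].
  pose proof (chord_speed_sq s) as Hsq. pose proof (transverse_turning s) as Hturn.
  pose proof (dot_z_N s) as HzN.
  assert (Hcst : forall c x r, vderiv c s x -> (forall t, dot d (w t) (c t) = r) ->
    dot d dw (c s) + dot d (w s) x = 0).
  { intros c x r Hx H0. apply (uniqueness_limite (fun t => dot d (w t) (c t)) s).
    - apply derivable_pt_lim_dot; assumption.
    - apply (derivable_pt_lim_eqf (fun _ => r)); [intros; symmetry; apply H0|].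
      apply derivable_pt_lim_const. }
  assert (Hdwe : dot d dw (e s) = - (tau s * cd)).
  { pose proof (Hcst e _ 0 (vderiv_e s)
      (fun t => proj1 (proj2 (proj2 (proj2 (proj2 (frame_ze t))))))) as H.
    rewrite dot_add_r, !dot_scal_r, Hwz, Hww in H. lra. }
  assert (Hdwz : dot d dw (z s) = - (tau s * sd)).
  { pose proof (Hcst z _ 0 (vderiv_z s)
      (fun t => proj1 (proj2 (proj2 (proj2 (frame_ze t)))))) as H.
    rewrite dot_add_r, !dot_scal_r, Hwe, Hww in H. lra. }
  assert (Hdww : dot d dw (w s) = 0).
  { pose proof (Hcst w _ 1 Hdw (fun t => proj1 (proj2 (frame_vn t)))) as H.
    rewrite (dot_comm d (w s)) in H. lra. }
  pose proof (derivable_chord_length s) as Hdl.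
  assert (Hb : derivable_pt_lim (fun t => - b t) s (- ((dl s * tau s + l s * taud) * sd))).
  { refine (derivable_pt_lim_value _ _ _ _ (derivable_pt_lim_opp _ _ _
      (derivable_pt_lim_mult _ _ _ _ _ (derivable_pt_lim_mult _ _ _ _ _ Hdl Htau)
      (derivable_pt_lim_const sd s))) _).
    unfold fct_cte. ring. }
  assert (Ha : derivable_pt_lim a s (dk * l s + k s * dl s)).
  { refine (derivable_pt_lim_value _ _ _ _ (derivable_pt_lim_minus _ _ _ _ _
      (derivable_pt_lim_mult _ _ _ _ _ Hk Hdl) (derivable_pt_lim_const sd s)) _). ring. }
  pose proof (vderiv_add _ _ _ _ _ (vderiv_scal _ _ _ _ _ Hb (vderiv_e s))
    (vderiv_scal _ _ _ _ _ Ha Hdw)) as HQ.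
  pose proof (derivable_pt_lim_dot d N Q s _ _ (vderiv_N s) HQ) as HNQ.
  apply (derivable_pt_lim_eqf _ (fun _ => 0) _ _ transverse_tangent) in HNQ.
  pose proof (uniqueness_limite _ _ _ _ HNQ (derivable_pt_lim_const 0 s)) as E.
  cbv beta in E. rewrite (dot_comm d _ (Q s)), Hturn in E.
  pose proof (Hdir (e s)) as He. pose proof (Hdir (w s)) as Hwx. pose proof (Hdir dw) as Hdx.
  cbv beta in *.
  rewrite !dot_add_r, !dot_scal_r, !dot_add_r, !dot_scal_r in E.
  rewrite (dot_comm d (normal _) (z s)), HzN in E.
  rewrite Hwe, Hze, Hee in He.
  rewrite (dot_comm d (e s)), Hwe, Hww, (dot_comm d (z s)), Hwz in Hwx.
  rewrite (dot_comm d (e s)), (dot_comm d (w s)), (dot_comm d (z s)), Hdwe, Hdww, Hdwz in Hdx.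
  set (x := dot d (normal (Gam s)) (e s)) in *. set (y := dot d (normal (Gam s)) (w s)) in *.
  set (u := dot d (normal (Gam s)) dw) in *. set (K := cd + dl s) in *.
  set (A := k s * l s - sd) in *.
  set (b' := (dl s * tau s + l s * taud) * sd) in *.
  set (a' := dk * l s + k s * dl s) in *. set (B := l s * tau s * sd) in *.
  assert (E1 : sd * K * x = cd * cd * A) by lra.
  assert (E2 : sd * K * y = cd * cd * B) by lra.
  assert (E3 : sd * K * u = - (cd * cd * A * (tau s * cd)) + sd * sd * K * (tau s * sd)) by lra.
  (* [M] is [E] multiplied by [sd * K], which turns the products of [N] with [e], [w] and [dw] into
     the right-hand sides of [E1], [E2] and [E3]. *)
  assert (M : sd * K * (tau s * sd) - b' * (cd * cd * A)
    - B * (k s * sd * (sd * K) + tau s * cd * (cd * cd * B)) + a' * (cd * cd * B)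
    + A * (- (cd * cd * A * (tau s * cd)) + sd * sd * K * (tau s * sd)) = 0).
  { rewrite <- E3, <- E1, <- E2.
    match type of E with ?lhs = _ =>
      transitivity (sd * K * lhs); [ring|rewrite E; ring] end. }
  apply (Rmult_eq_reg_l (cd * cd)); [|nra].
  rewrite Rmult_0_r.
  replace (cd * cd * (l s * sd * A * taud + sd * ((A + sd * K / cd) * dl s - l s * a') * tau s))
    with (cd * cd * (A * b' - a' * B) + sd * sd * K * (dl s) * tau s * cd)
    by (unfold b', B; field; lra).
  replace (cd * cd * (A * b' - a' * B)) with
    (sd * K * (tau s * sd) - B * k s * sd * sd * K
      - tau s * cd * (cd * cd * (A * A + B * B)) + A * sd * sd * K * (tau s * sd)) by lra.
  (* The length relation removes [A * A + B * B]; expressing [dl s] by [K], [B * k s] by [A], and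
     inserting [sd * sd + cd * cd] in one term leaves a polynomial identity. *)
  rewrite Hsq.
  replace (dl s) with (K - cd) by (unfold K; ring).
  replace (B * k s) with (tau s * sd * (A + sd)) by (unfold A, B; ring).
  replace (sd * K * (tau s * sd)) with (sd * K * (tau s * sd) * (sd * sd + cd * cd))
    by (rewrite Hsc; ring).
  ring.
Qed.

(** * Continuity of the coefficients and vanishing of [tau] *)

Context (Htausm : smooth1 tau) (Hwsm : forall i, smooth1 (fun s => w s i)).

Lemma tau_C1 : exists dtau, forall s, derivable_pt_lim tau s (dtau s).
Proof.
  destruct Htausm as [fs [H0 H1]]. exists (fs 1%nat). intros s.
  exact (derivable_pt_lim_eqf _ _ _ _ H0 (H1 0%nat s)).
Qed.

Lemma w_C1 (s : R) : exists dw, vderiv w s dw.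
Proof.
  assert (H : forall i, exists r, derivable_pt_lim (fun t => w t i) s r).
  { intros i. destruct (Hwsm i) as [fs [H0 H1]]. exists (fs 1%nat s).
    exact (derivable_pt_lim_eqf _ _ _ _ H0 (H1 0%nat s)). }
  exists (fun i => proj1_sig (constructive_indefinite_description _ (H i))).
  intros i. apply proj2_sig.
Qed.

Lemma continuity_dot_N (c : R -> vec) :
  (forall s, exists u, vderiv c s u) -> continuity (fun s => dot d (c s) (N s)).
Proof.
  intros H s. destruct (H s) as [u Hu].
  exact (derivable_pt_lim_cont _ _ _ (derivable_pt_lim_dot d c N s _ _ Hu (vderiv_N s))).
Qed.

Lemma continuity_chord_length : continuity l.
Proof. exact (derivable_continuity l dl derivable_chord_length). Qed.

Lemma continuity_k : continuity k.
Proof. destruct curvature_C1 as [dk [_ H]]. exact (derivable_continuity k dk H). Qed.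

Lemma continuity_chord_speed : continuity dl.
Proof.
  destruct tau_C1 as [dtau Hdtau].
  unfold chord_speed, Rdiv.
  repeat first [apply continuity_cst | apply continuity_k | apply continuity_chord_length
    | exact (derivable_continuity tau dtau Hdtau)
    | apply continuity_dot_N; intros s; first [apply w_C1 | eexists; apply vderiv_e
        | eexists; exact (Hgeod s)]
    | apply continuity_add | apply continuity_mul].
Qed.

Lemma torsion_equation :
  exists B : R -> R, continuity B /\
    forall s taud, derivable_pt_lim tau s taud -> l s * sd * a s * taud + B s * tau s = 0.
Proof.
  destruct curvature_C1 as [dk [Hdk Hk]].
  exists (fun s => sd * ((a s + sd * (cd + dl s) / cd) * dl s
                         - l s * (dk s * l s + k s * dl s))).
  split.
  - unfold Rdiv, Rminus.
    repeat first [apply continuity_cst | apply continuity_k | apply continuity_chord_length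
      | apply continuity_chord_speed | exact Hdk | apply (continuity_opp (fun s => _))
      | apply continuity_add | apply continuity_mul].
  - intros s taud Htau. destruct (w_C1 s) as [dw Hdw].
    exact (torsion_ode s (dk s) taud dw (Hk s) Htau Hdw).
Qed.

(* Where [tau] vanishes the leading coefficient does not, so the zero set of [tau],
   which is closed, is also open. *)
Lemma torsion_vanishes (s0 : R) : tau s0 = 0 -> forall s, tau s = 0.
Proof.
  destruct tau_C1 as [dtau Hdtau]. destruct torsion_equation as [B [HB Heq]].
  pose proof sin_cos_delta_pos as [Hs Hc].
  apply zero_open_everywhere; [exact (derivable_continuity tau dtau Hdtau)|].
  intros s H0.
  apply (linear_ode_zero tau dtau (fun s => l s * sd * a s) B s Hdtau); auto.
  - unfold Rminus.
    repeat first [apply continuity_cst | apply continuity_k | apply continuity_chord_length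
      | apply continuity_add | apply continuity_mul].
  - pose proof (chord_speed_sq s) as Hsq. destruct (chord_end_direction s) as [HK _].
    destruct (Hl s) as [Hl0 _]. cbv beta in *. rewrite H0 in Hsq.
    assert (HA : k s * l s - sd <> 0).
    { intros HA. rewrite HA in Hsq.
      assert (0 < (sd * (cd + dl s)) * (sd * (cd + dl s))); [|lra].
      apply Rsqr_pos_lt. apply Rmult_integral_contrapositive_currified; [lra|exact HK]. }
    apply Rmult_integral_contrapositive_currified; [nra|exact HA].
Qed.

End Hypersurface.

Theorem theorem2p4
  (d : nat) (F : vec -> R) (gradF : vec -> vec) (hessF : vec -> nat -> nat -> R)
  (delta : R)
  (HS : strictly_convex_hypersurface d F gradF hessF)
  (Hdelta : 0 < delta < PI / 2)
  (HG : gutkin d F gradF delta)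
  (gamma v w : R -> vec) (k tau l : R -> R)
  (* gamma : smooth arc-length parametrized geodesic of S, v = gamma' *)
  (Hon : forall s, onS d F (gamma s))
  (Hgsm : forall i, smooth1 (fun s => gamma s i))
  (Hv : forall s i, derivable_pt_lim (fun t => gamma t i) s (v s i))
  (Hvunit : forall s, vnorm d (v s) = 1)
  (Hgeod : forall s i, derivable_pt_lim (fun t => v t i) s
                         (k s * inner_normal d gradF (gamma s) i))
  (* n' = -k v + tau w, with w unit and orthogonal to v and n *)
  (Hn : forall s i, derivable_pt_lim (fun t => inner_normal d gradF (gamma t) i) s
                      (- k s * v s i + tau s * w s i))
  (Hw : forall s, inRd d (w s) /\ vnorm d (w s) = 1 /\ dot d (w s) (v s) = 0 /\
                  dot d (w s) (inner_normal d gradF (gamma s)) = 0)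
  (* tau and w smooth along gamma *)
  (Htausm : smooth1 tau)
  (Hwsm : forall i, smooth1 (fun s => w s i))
  (* l(s) : length of the chord from gamma(s) in direction
     z(s) = cos delta v(s) + sin delta n(s) *)
  (Hl : forall s, 0 < l s /\
        onS d F (vadd (gamma s)
                   (vscal (l s) (vadd (vscal (cos delta) (v s))
                                      (vscal (sin delta) (inner_normal d gradF (gamma s))))))) :
  (exists B : R -> R, continuity B /\
     forall s taud, derivable_pt_lim tau s taud ->
       l s * sin delta * (k s * l s - sin delta) * taud + B s * tau s = 0) /\
  (forall s0, tau s0 = 0 -> forall s, tau s = 0).
Proof.
  split.
  - exact (torsion_equation d F gradF hessF HS delta Hdelta HG gamma v w k tau l
      Hon Hgsm Hv Hvunit Hgeod Hn Hw Hl Htausm Hwsm).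
  - exact (torsion_vanishes d F gradF hessF HS delta Hdelta HG gamma v w k tau l
      Hon Hgsm Hv Hvunit Hgeod Hn Hw Hl Htausm Hwsm).
Qed.
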